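(* Let $G$ be a highly computable graph with finitely many ends. Let $\mathrm{Sep}(G)$ be the collection of finite sets of edges $E\subset E(G)$ such that $G\smallsetminus E$ has at least two infinite connected components, and $\mathrm{SepMax}(G)$ the collection of finite sets of edges $E\subset E(G)$ such that the number of infinite connected components of $G\smallsetminus E$ equals the number of ends of $G$. Then: (1) There is an algorithm which with oracle access to $\mathrm{SepMax}(G)$ computes the number of ends of $G$ and $\mathrm{Sep}(G)$. This algorithm is uniform on $G$. (2) There is an algorithm which given the number of ends of $G$ and with oracle access to $\mathrm{Sep}(G)$, decides membership in $\mathrm{SepMax}(G)$.
   Context: Graphs are connected and locally finite. A graph $G$ is highly computable when $V(G)$ is a decidable subset of $\mathbb{N}$, the adjacency relation is decidable, $G$ is locally finite and the vertex degree function is computable. $G\smallsetminus E$ is the subgraph induced by $E(G)\smallsetminus E$. The number of ends of $G$ is the supremum, over finite $E\subset E(G)$, of the number of infinite connected components of $G\smallsetminus E$.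
   Formalization: In (1), the uniform computation of the number of ends is claimed only for infinite G: finite and one-ended graphs both have every finite edge set in SepMax(G), so a uniform algorithm covering finite graphs too would decide halting. *)

(* Defs.v *)
From Stdlib Require Import Relations Cantor.
From mathcomp Require Import all_boot all_classical.

Set Implicit Arguments.
Unset Strict Implicit.
Unset Printing Implicit Defensive.

Local Open Scope classical_set_scope.
Local Open Scope card_scope.

(** * Oracle computability: partial recursive functions on [nat] *)

Definition npair (x y : nat) : nat := Cantor.to_nat (x, y).

Inductive code : Type :=
| CZero | CSucc | CFst | CSnd | COracle
| CPair of code & code
| CComp of code & code
| CPrec of code & code
| CMu of code.

(** [eval O c x y]: the program [c] with oracle [O] halts on input [x] with
    output [y]. The unary functions on [nat] are composed with the Cantor
    pairing, which encodes tuples of arguments. *)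
Inductive eval (O : set nat) : code -> nat -> nat -> Prop :=
| eval_zero x : eval O CZero x 0
| eval_succ x : eval O CSucc x x.+1
| eval_fst x y : eval O CFst (npair x y) x
| eval_snd x y : eval O CSnd (npair x y) y
| eval_oracle_in x : O x -> eval O COracle x 1
| eval_oracle_out x : ~ O x -> eval O COracle x 0
| eval_pair f g x y z :
    eval O f x y -> eval O g x z -> eval O (CPair f g) x (npair y z)
| eval_comp f g x y z :
    eval O g x y -> eval O f y z -> eval O (CComp f g) x z
| eval_prec0 f g x y :
    eval O f x y -> eval O (CPrec f g) (npair x 0) y
| eval_precS f g x n y z :
    eval O (CPrec f g) (npair x n) y ->
    eval O g (npair x (npair n y)) z ->
    eval O (CPrec f g) (npair x n.+1) z
| eval_mu f x n :
    (forall m, m < n -> exists y, eval O f (npair x m) y.+1) ->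
    eval O f (npair x n) 0 ->
    eval O (CMu f) x n.

Definition decides (O : set nat) (c : code) (x : nat) (P : Prop) : Prop :=
  (P -> eval O c x 1) /\ (~ P -> eval O c x 0).

(** Gödel numbering of programs. *)
Fixpoint code_num (c : code) : nat :=
  match c with
  | CZero => npair 0 0
  | CSucc => npair 1 0
  | CFst => npair 2 0
  | CSnd => npair 3 0
  | COracle => npair 4 0
  | CPair f g => npair 5 (npair (code_num f) (code_num g))
  | CComp f g => npair 6 (npair (code_num f) (code_num g))
  | CPrec f g => npair 7 (npair (code_num f) (code_num g))
  | CMu f => npair 8 (code_num f)
  end.

(** * Graphs *)

Record graph : Type := Graph {
  vert : set nat;
  adj : nat -> nat -> Prop;
  adj_sym : forall u v, adj u v -> adj v u;
  adj_irr : forall u, ~ adj u u;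
  adj_vert : forall u v, adj u v -> vert u }.

(** The unordered pair {u, v} is represented by (min, max). *)
Definition edge (u v : nat) : nat * nat := (minn u v, maxn u v).

Definition edges (G : graph) : set (nat * nat) :=
  [set e | exists u v, adj G u v /\ e = edge u v].

Definition neighbors (G : graph) (v : nat) : set nat := [set w | adj G v w].

Definition locally_finite (G : graph) : Prop :=
  forall v, vert G v -> finite_set (neighbors G v).

Definition connected (G : graph) : Prop :=
  forall u v, vert G u -> vert G v -> clos_refl_trans nat (adj G) u v.

Section Delete.
Variables (G : graph) (E : set (nat * nat)).

Definition del_adj (u v : nat) : Prop := adj G u v /\ ~ E (edge u v).

Definition del_vert : set nat := [set u | exists v, del_adj u v].

Lemma del_adj_sym u v : del_adj u v -> del_adj v u.
Proof. by rewrite /del_adj /edge minnC maxnC => -[/adj_sym]. Qed.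

Lemma del_adj_irr u : ~ del_adj u u.
Proof. by case=> /adj_irr. Qed.

Lemma del_adj_vert u v : del_adj u v -> del_vert u.
Proof. by exists v. Qed.

(** The subgraph induced by the edges of [G] outside [E]: its vertices are
    the endpoints of the remaining edges. *)
Definition delete_edges : graph := Graph del_adj_sym del_adj_irr del_adj_vert.

End Delete.

Definition component (G : graph) (v : nat) : set nat :=
  [set w | clos_refl_trans nat (adj G) v w].

Definition components (G : graph) : set (set nat) := component G @` vert G.

Definition inf_components (G : graph) : set (set nat) :=
  [set C | components G C /\ infinite_set C].

Definition finite_edge_set (G : graph) (E : set (nat * nat)) : Prop :=
  finite_set E /\ E `<=` edges G.

Definition ends_bound (G : graph) (k : nat) : Prop :=
  forall E, finite_edge_set G E -> inf_components (delete_edges G E) #<= `I_k.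

(** [G] has finitely many ends and their number, a supremum, is [k]. *)
Definition number_of_ends (G : graph) (k : nat) : Prop :=
  ends_bound G k /\ forall m, ends_bound G m -> k <= m.

Definition Sep (G : graph) : set (set (nat * nat)) :=
  [set E | finite_edge_set G E /\ `I_2 #<= inf_components (delete_edges G E)].

Definition SepMax (G : graph) : set (set (nat * nat)) :=
  [set E | finite_edge_set G E /\
    exists k, number_of_ends G k /\ inf_components (delete_edges G E) #= `I_k].

(** * Highly computable graphs and encodings *)

Record description : Type := Description {
  vert_code : code;
  adj_code : code;
  deg_code : code }.

(** [G] is a highly computable graph, as witnessed by the programs in [d]
    (run with the empty oracle). *)
Definition highly_computable_by (d : description) (G : graph) : Prop :=
  [/\ locally_finite G,
      forall v, decides set0 (vert_code d) v (vert G v),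
      forall u v, vert G u -> vert G v ->
        decides set0 (adj_code d) (npair u v) (adj G u v)
    & forall v n, vert G v -> neighbors G v #= `I_n ->
        eval set0 (deg_code d) v n].

Definition description_num (d : description) : nat :=
  npair (code_num (vert_code d))
        (npair (code_num (adj_code d)) (code_num (deg_code d))).

(** A finite set of edges is presented by any list enumerating it. *)
Fixpoint edges_num (s : seq (nat * nat)) : nat :=
  if s is e :: s' then (npair (npair e.1 e.2) (edges_num s')).+1 else 0.

Definition oracle_of (A : set (set (nat * nat))) : set nat :=
  [set n | exists s : seq (nat * nat), n = edges_num s /\ A [set` s]].

(* Main.v *)
(** Let [K] be a finite connected set of vertices, [F] the set of edges incident
    to [K] and [C_0, ..., C_{m-1}] the components of [G] minus [F] outside [K].
    For [K] large enough, every [C_i] is infinite and [m] is the number of ends,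
    and the data can be verified by finitely many oracle queries.
    With [SepMax]: [F] is in [SepMax], and for each pair [i, j], restoring the
    edges of [F] inside [K], [C_i] and [C_j] leaves [SepMax], which can only
    happen when [C_i] and [C_j] are distinct and infinite.
    With [Sep]: for each [i], restoring the edges of [F] that join [K] and the
    [C_j], [j <> i], leaves two infinite components, one of which must be [C_i].
    Given such data with [s] included in [F], the set [s] is in [Sep] (in [SepMax])
    iff some two (any two) of the [C_i] are disconnected in [G] minus [s]. Both
    connection and, by a 2-colouring of [K] and the [C_i], disconnection have finite
    certificates, so an unbounded search over certificates decides the question. *)

From Stdlib Require Import Relations Cantor.
From mathcomp Require Import all_boot all_classical zify.
Require Import Defs.

Set Implicit Arguments.
Unset Strict Implicit.
Unset Printing Implicit Defensive.

Local Open Scope classical_set_scope.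

(** * Computable functions and recursively enumerable relations *)

(** A graph enters the algorithms only through the number of a description, so its programs must be
    simulated; [univ] does this by searching for finite derivations of evaluations under the empty
    oracle. All questions are phrased as [re] relations, which admit existential quantifiers,
    bounded universal ones and oracle queries of either sign, but no general negation. Each negative
    fact (non-adjacency, a pair that is not an edge, disconnection) therefore needs a positive
    certificate of its own, and the answers yes and no become two clauses of one relation. Once this
    relation is shown to be single-valued, searching it computes the answer. The certificates yield
    infinite components only by comparing two of them, so graphs with at most one end are treated
    apart. With [SepMax] they are recognised by one query, on the empty edge set, whose code is 0.
    That query cannot tell zero ends from one, which is why an infinite vertex set is assumed when
    the number of ends is computed. *)

Definition nfst (n : nat) : nat := (Cantor.of_nat n).1.
Definition nsnd (n : nat) : nat := (Cantor.of_nat n).2.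

Lemma nfst_pair x y : nfst (npair x y) = x.
Proof. by rewrite /nfst /npair Cantor.cancel_of_to. Qed.

Lemma nsnd_pair x y : nsnd (npair x y) = y.
Proof. by rewrite /nsnd /npair Cantor.cancel_of_to. Qed.

Lemma npair_eta n : npair (nfst n) (nsnd n) = n.
Proof.
by rewrite /npair /nfst /nsnd -[RHS]Cantor.cancel_to_of; case: (Cantor.of_nat n).
Qed.

Definition npairK := (nfst_pair, nsnd_pair).

Lemma npair_inj x y x' y' : npair x y = npair x' y' -> x = x' /\ y = y'.
Proof.
move=> e; split; first by rewrite -(nfst_pair x y) e nfst_pair.
by rewrite -(nsnd_pair x y) e nsnd_pair.
Qed.

Lemma nsnd_le n : nsnd n <= n.
Proof.
have := Cantor.to_nat_non_decreasing (nfst n) (nsnd n).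
rewrite -/(npair _ _) npair_eta; lia.
Qed.

Global Opaque npair nfst nsnd.

(** The program is quantified before the oracle, so whatever is built from [comp] is uniform in the
    oracle, hence later in the graph. *)
Definition comp (f : set nat -> nat -> nat) : Prop :=
  exists c, forall O x, eval O c x (f O x).

Section CompClosure.
Implicit Types a b f : set nat -> nat -> nat.

Lemma comp_ext f g : (forall O x, f O x = g O x) -> comp f -> comp g.
Proof. by move=> fg [c Hc]; exists c => O x; rewrite -fg. Qed.

Lemma comp_comp f a : comp f -> comp a -> comp (fun O x => f O (a O x)).
Proof.
move=> [cf Hf] [ca Ha]; exists (CComp cf ca) => O x.
by apply: eval_comp (Hf _ _).
Qed.

Lemma comp_pair a b :
  comp a -> comp b -> comp (fun O x => npair (a O x) (b O x)).
Proof.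
by move=> [ca Ha] [cb Hb]; exists (CPair ca cb) => O x; apply: eval_pair.
Qed.

Lemma comp_fst a : comp a -> comp (fun O x => nfst (a O x)).
Proof.
apply: (@comp_comp (fun _ x => nfst x)); exists CFst => O x.
by rewrite -{1}(npair_eta x); apply: eval_fst.
Qed.

Lemma comp_snd a : comp a -> comp (fun O x => nsnd (a O x)).
Proof.
apply: (@comp_comp (fun _ x => nsnd x)); exists CSnd => O x.
by rewrite -{1}(npair_eta x); apply: eval_snd.
Qed.

Lemma comp_succ a : comp a -> comp (fun O x => (a O x).+1).
Proof. by apply: (@comp_comp (fun _ x => x.+1)); exists CSucc => O x; constructor. Qed.

Lemma comp_cst n : comp (fun _ _ => n).
Proof.
elim: n => [|n IH]; last exact: comp_succ IH.
by exists CZero => O x; constructor.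
Qed.

Lemma comp_id : comp (fun _ x => x).
Proof.
(* No basic program is the identity; pairing the two projections gives it, since every number is a
   pair. *)
exists (CPair CFst CSnd) => O x; rewrite -(npair_eta x).
by apply: eval_pair; constructor.
Qed.

Lemma comp_oracle a : comp a -> comp (fun O x => nat_of_bool `[< O (a O x) >]).
Proof.
apply: (@comp_comp (fun O x => nat_of_bool `[< O x >])); exists COracle => O x.
by case: asboolP => h; constructor.
Qed.

Lemma comp_rec a (g : set nat -> nat -> nat -> nat -> nat) b :
  comp a -> comp (fun O x => g O (nfst x) (nfst (nsnd x)) (nsnd (nsnd x))) ->
  comp b ->
  comp (fun O x => nat_rect (fun=> nat) (a O x) (g O x) (b O x)).
Proof.
move=> [ca Ha] [cg Hg] Cb.
have : comp (fun O x =>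
    nat_rect (fun=> nat) (a O (nfst x)) (g O (nfst x)) (nsnd x)); last first.
  move/comp_comp/(_ (comp_pair comp_id Cb)); apply: comp_ext => O x.
  by rewrite !npairK.
exists (CPrec ca cg) => O x; rewrite -{1}(npair_eta x).
elim: (nsnd x) => [|n IH] /=; first exact: eval_prec0.
apply: eval_precS IH _; set r := nat_rect _ _ _ n.
by have := Hg O (npair (nfst x) (npair n r)); rewrite !npairK.
Qed.

End CompClosure.

(** Syntax-directed proofs of [comp]. The hook [comp_ext_tac] is redefined whenever new functions
    acquire closure lemmas. *)
Ltac comp_tac :=
  lazymatch goal with
  | H : comp ?a |- comp ?a => exact H
  | |- comp (fun _ x => x) => exact comp_id
  | |- comp (fun _ _ => ?n) => exact (comp_cst n)
  | |- comp (fun O x => nfst (@?a O x)) => apply (@comp_fst a); comp_tac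
  | |- comp (fun O x => nsnd (@?a O x)) => apply (@comp_snd a); comp_tac
  | |- comp (fun O x => npair (@?a O x) (@?b O x)) =>
      apply (@comp_pair a b); comp_tac
  | |- comp (fun O x => (@?a O x).+1) => apply (@comp_succ a); comp_tac
  | |- comp (fun O x => nat_rect (fun=> nat) (@?a O x) (@?g O x) (@?b O x)) =>
      apply (@comp_rec a g b); comp_tac
  | _ => comp_ext_tac
  end
with comp_ext_tac :=
  lazymatch goal with
  | |- comp (fun O x => ?f O (@?a O x)) => apply (@comp_comp f a); comp_tac
  end.

Section Arithmetic.
Implicit Types a b : set nat -> nat -> nat.

Lemma comp_pred a : comp a -> comp (fun O x => (a O x).-1).
Proof.
move=> Ca; apply: (@comp_ext (fun O x =>
  nat_rect (fun=> nat) 0 (fun n _ => n) (a O x))); first by move=> O x; case: (a O x).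
comp_tac.
Qed.

Lemma comp_add a b : comp a -> comp b -> comp (fun O x => a O x + b O x).
Proof.
move=> Ca Cb; apply: (@comp_ext (fun O x =>
  nat_rect (fun=> nat) (a O x) (fun _ r => r.+1) (b O x))).
  by move=> O x; elim: (b O x) => /= [|n ->]; lia.
comp_tac.
Qed.

Lemma comp_sub a b : comp a -> comp b -> comp (fun O x => a O x - b O x).
Proof.
move=> Ca Cb; apply: (@comp_ext (fun O x =>
  nat_rect (fun=> nat) (a O x) (fun _ r => r.-1) (b O x))).
  by move=> O x; elim: (b O x) => /= [|n ->]; lia.
by apply: (@comp_rec _ (fun _ _ _ r => r.-1)) => //; apply: comp_pred; comp_tac.
Qed.

Lemma comp_mul a b : comp a -> comp b -> comp (fun O x => a O x * b O x).
Proof.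
move=> Ca Cb; apply: (@comp_ext (fun O x =>
  nat_rect (fun=> nat) 0 (fun _ r => r + a O x) (b O x))).
  by move=> O x; elim: (b O x) => /= [|n ->]; lia.
apply: (@comp_rec _ (fun O x _ r => r + a O x)) => //; first by comp_tac.
by apply: comp_add; comp_tac.
Qed.

Lemma comp_min a b : comp a -> comp b -> comp (fun O x => minn (a O x) (b O x)).
Proof.
move=> Ca Cb; apply: (@comp_ext (fun O x => a O x - (a O x - b O x))).
  by move=> O x; lia.
by repeat (apply: comp_sub || apply: comp_add).
Qed.

Lemma comp_max a b : comp a -> comp b -> comp (fun O x => maxn (a O x) (b O x)).
Proof.
move=> Ca Cb; apply: (@comp_ext (fun O x => a O x + (b O x - a O x))).
  by move=> O x; lia.
by repeat (apply: comp_sub || apply: comp_add).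
Qed.

End Arithmetic.

Ltac comp_ext_tac ::=
  lazymatch goal with
  | |- comp (fun O x => (@?a O x).-1) => apply (@comp_pred a); comp_tac
  | |- comp (fun O x => @?a O x + @?b O x) => apply (@comp_add a b); comp_tac
  | |- comp (fun O x => @?a O x - @?b O x) => apply (@comp_sub a b); comp_tac
  | |- comp (fun O x => @?a O x * @?b O x) => apply (@comp_mul a b); comp_tac
  | |- comp (fun O x => minn (@?a O x) (@?b O x)) => apply (@comp_min a b); comp_tac
  | |- comp (fun O x => maxn (@?a O x) (@?b O x)) => apply (@comp_max a b); comp_tac
  | |- comp (fun O x => ?f O (@?a O x)) => apply (@comp_comp f a); comp_tac
  end.

(** Semidecidability relative to the oracle, by a total test. Acceptance is the value zero because
    [CMu] searches for zeros. *)
Definition re (R : set nat -> nat -> Prop) : Prop :=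
  exists f, comp f /\ forall O x, R O x <-> exists n, f O (npair x n) = 0.

Section ReClosure.
Implicit Types (a b : set nat -> nat -> nat) (R S : set nat -> nat -> Prop).

Lemma re_ext R S : (forall O x, R O x <-> S O x) -> re R -> re S.
Proof. by move=> RS [f [Cf Hf]]; exists f; split=> // O x; rewrite -RS. Qed.

Lemma re_eq0 a : comp a -> re (fun O x => a O x = 0).
Proof.
move=> Ca; exists (fun O x => a O (nfst x)); split; first by comp_tac.
move=> O x; split=> [h|[n]]; last by rewrite npairK.
by exists 0; rewrite npairK.
Qed.

Lemma re_eq a b : comp a -> comp b -> re (fun O x => a O x = b O x).
Proof.
move=> Ca Cb; apply: (@re_ext (fun O x => (a O x - b O x) + (b O x - a O x) = 0)).
  by move=> O x; lia.
by apply: re_eq0; comp_tac.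
Qed.

Lemma re_neq a b : comp a -> comp b -> re (fun O x => a O x <> b O x).
Proof.
move=> Ca Cb.
apply: (@re_ext (fun O x => 1 - ((a O x - b O x) + (b O x - a O x)) = 0)).
  by move=> O x; lia.
by apply: re_eq0; comp_tac.
Qed.

Lemma re_leq a b : comp a -> comp b -> re (fun O x => a O x <= b O x).
Proof.
move=> Ca Cb; apply: (@re_ext (fun O x => a O x - b O x = 0)).
  by move=> O x; lia.
by apply: re_eq0; comp_tac.
Qed.

Lemma re_oracle a : comp a -> re (fun O x => O (a O x)).
Proof.
move=> Ca; apply: (@re_ext (fun O x => 1 - nat_of_bool `[< O (a O x) >] = 0)).
  by move=> O x; case: asboolP.
by apply: re_eq0; apply: comp_sub; [comp_tac | apply: comp_oracle].
Qed.

(** The oracle answers every query, so a negative answer is as finite a piece of evidence as a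
    positive one. *)
Lemma re_oracleN a : comp a -> re (fun O x => ~ O (a O x)).
Proof.
move=> Ca; apply: (@re_ext (fun O x => nat_of_bool `[< O (a O x) >] = 0)).
  by move=> O x; case: asboolP.
by apply: re_eq0; apply: comp_oracle.
Qed.

Lemma re_and R S : re R -> re S -> re (fun O x => R O x /\ S O x).
Proof.
move=> [f [Cf Hf]] [g [Cg Hg]].
exists (fun O x => f O (npair (nfst x) (nfst (nsnd x))) +
                   g O (npair (nfst x) (nsnd (nsnd x)))); split; first by comp_tac.
move=> O x; rewrite Hf Hg; split=> [[[n n0] [m m0]]|[n]].
  by exists (npair n m); rewrite !npairK n0 m0.
rewrite !npairK => h; split; [exists (nfst n)|exists (nsnd n)]; lia.
Qed.

Lemma re_or R S : re R -> re S -> re (fun O x => R O x \/ S O x).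
Proof.
move=> [f [Cf Hf]] [g [Cg Hg]].
exists (fun O x => f O x * g O x); split; first by comp_tac.
move=> O x; rewrite Hf Hg; split=> [[[n n0]|[n n0]]|[n h]].
- by exists n; rewrite n0.
- by exists n; rewrite n0 muln0.
have [h'|h'] : f O (npair x n) = 0 \/ g O (npair x n) = 0 by nia.
  by left; exists n.
by right; exists n.
Qed.

Lemma re_ex (R : set nat -> nat -> nat -> Prop) :
  re (fun O x => R O (nfst x) (nsnd x)) -> re (fun O x => exists y, R O x y).
Proof.
move=> [f [Cf Hf]].
exists (fun O x => f O (npair (npair (nfst x) (nfst (nsnd x))) (nsnd (nsnd x)))).
split; first by comp_tac.
move=> O x; split=> [[y]|[n]].
  have := Hf O (npair x y); rewrite !npairK => -> [n n0].
  by exists (npair y n); rewrite !npairK.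
rewrite !npairK => h; exists (nfst n).
by have := Hf O (npair x (nfst n)); rewrite !npairK => ->; exists (nsnd n).
Qed.

(** Finitely many [y] have a common bound [N] on their witnesses, and only [N] is searched for.
    Below it, a product over candidate witnesses expresses the existential quantifier and a sum over
    [y] the universal one. *)
Lemma re_all_lt (R : set nat -> nat -> nat -> Prop) b :
  comp b -> re (fun O x => R O (nfst x) (nsnd x)) ->
  re (fun O x => forall y, y < b O x -> R O x y).
Proof.
move=> Cb [f [Cf Hf]].
pose h O x y N := nat_rect (fun=> nat) 1 (fun n r => r * f O (npair (npair x y) n)) N.
have hP O x y N : h O x y N = 0 <-> exists2 n, n < N & f O (npair (npair x y) n) = 0.
  elim: N => /= [|N IH]; first by split=> // -[].
  split=> [hN|[n nN n0]].
    have [h0|h0] : h O x y N = 0 \/ f O (npair (npair x y) N) = 0.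
    - by move: hN; rewrite /= -/(h O x y N); nia.
    - by have [n nN n0] := proj1 IH h0; exists n => //; lia.
    - by exists N.
  rewrite -/(h O x y N); have [<-|nN'] := eqVneq n N; first by rewrite n0 muln0.
  by rewrite (proj2 IH) //; exists n => //; lia.
pose s O x N B := nat_rect (fun=> nat) 0 (fun y r => r + h O x y N) B.
have sP O x N B : s O x N B = 0 <-> forall y, y < B -> h O x y N = 0.
  elim: B => /= [|B IH]; first by split.
  rewrite -/(s O x N B); split=> [hs y yB|hs].
    have [->|yB'] := eqVneq y B; first lia.
    by apply: (proj1 IH); lia.
  by rewrite (hs B) // (proj2 IH) // => y yB; apply: hs; lia.
exists (fun O x => s O (nfst x) (nsnd x) (b O (nfst x))); split.
  by rewrite /s /h; comp_tac.
move=> O x; split=> [hR|[N]].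
  have [N HN] : exists N, forall y, y < b O x -> h O x y N = 0.
    elim: (b O x) hR => [|B IH] hR; first by exists 0.
    have [|N HN] := IH; first by move=> y yB; apply: hR; lia.
    have := hR B (ltnSn B); have := Hf O (npair x B); rewrite !npairK => -> [n n0].
    exists (N + n.+1) => y yB; apply/hP.
    have [->|yB'] := eqVneq y B; first by exists n => //; lia.
    have [|m mN m0] := proj1 (hP O x y N) (HN y _); first lia.
    by exists m => //; lia.
  by exists N; rewrite !npairK; apply/sP.
rewrite !npairK => /sP hs y /hs /hP[n _ n0].
by have := Hf O (npair x y); rewrite !npairK => ->; exists n.
Qed.

Lemma re_subst R a : re R -> comp a -> re (fun O x => R O (a O x)).
Proof.
move=> [f [Cf Hf]] Ca; exists (fun O x => f O (npair (a O (nfst x)) (nsnd x))).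
split; first by comp_tac.
by move=> O x; rewrite Hf; split=> -[n hn]; exists n; move: hn; rewrite !npairK.
Qed.

End ReClosure.

(* Unbounded search for a pair (output, witness). *)
Lemma re_functional_code (R : set nat -> nat -> nat -> Prop) :
  re (fun O x => R O (nfst x) (nsnd x)) ->
  exists c, forall O x y,
    R O x y -> (forall y', R O x y' -> y' = y) -> eval O c x y.
Proof.
move=> [f [Cf Hf]].
have [c Hc] : comp (fun O x =>
  f O (npair (npair (nfst x) (nfst (nsnd x))) (nsnd (nsnd x)))) by comp_tac.
exists (CComp CFst (CMu c)) => O x y Rxy Runiq.
have HR y' : R O x y' <-> exists n, f O (npair (npair x y') n) = 0.
  by have := Hf O (npair x y'); rewrite !npairK.
have exP : exists p, f O (npair (npair x (nfst p)) (nsnd p)) == 0.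
  by have [n n0] := proj1 (HR y) Rxy; exists (npair y n); rewrite !npairK n0.
have [p /eqP p0 pmin] := ex_minnP exP.
(* The first successful pair need not carry the witness at hand, but uniqueness of the output forces
   its first component. *)
have -> : y = nfst p by symmetry; apply: Runiq; apply/HR; exists (nsnd p).
apply: (@eval_comp _ _ _ _ p); last by rewrite -{1}(npair_eta p); constructor.
constructor; last by have := Hc O (npair x p); rewrite !npairK p0.
(* [CMu] also requires the test to halt with a nonzero value at each smaller [m]: the test is total,
   and minimality of [p] excludes zero. *)
move=> m mp; have := Hc O (npair x m); rewrite !npairK.
case E: (f _ _) => [|r]; last by exists r.
by have := pmin m; rewrite E eqxx => /(_ isT); lia.
Qed.

Ltac re_tac :=
  cbv beta;
  lazymatch goal with
  | H : re ?R |- re ?R => exact H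
  | |- re (fun O x => @?R O x /\ @?S O x) => apply (@re_and R S); re_tac
  | |- re (fun O x => @?R O x \/ @?S O x) => apply (@re_or R S); re_tac
  | |- re (fun O x => exists y, @?R O x y) => apply (@re_ex R); re_tac
  | |- re (fun O x => forall y, is_true (y < @?b O x) -> @?R O x y) =>
      apply (@re_all_lt R b); [comp_tac | re_tac]
  | |- re (fun O x => is_true (@?a O x <= @?b O x)) =>
      apply (@re_leq a b); comp_tac
  | |- re (fun O x => @?a O x = @?b O x) => apply (@re_eq a b); comp_tac
  | |- re (fun O x => @?a O x <> @?b O x) => apply (@re_neq a b); comp_tac
  | |- re (fun O x => O (@?a O x)) => apply (@re_oracle a); comp_tac
  | |- re (fun O x => ~ O (@?a O x)) => apply (@re_oracleN a); comp_tac
  | _ => re_ext_tac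
  end
with re_ext_tac := idtac.

(** * Finite sequences coded by natural numbers *)

(** Zero is the empty list and a successor packs a head and a tail. This is the format of
    [edges_num], so edge sets received as input are read directly; and every number codes a list, so
    quantifying over lists is quantifying over numbers. *)
Definition nhd (L : nat) : nat := nfst L.-1.
Definition ntl (L : nat) : nat := nsnd L.-1.
Definition ndrop (j L : nat) : nat := nat_rect (fun=> nat) L (fun _ r => ntl r) j.
Definition nnth (L j : nat) : nat := nhd (ndrop j L).
(** The condition [ndrop j L <> 0] excludes positions past the end, where [nnth] returns a
    meaningless default. *)
Definition nmem (x L : nat) : Prop := exists j, ndrop j L <> 0 /\ x = nnth L j.
Definition ncons (x L : nat) : nat := (npair x L).+1.
Definition ncode (s : seq nat) : nat := foldr ncons 0 s.

Lemma nhd_cons x L : nhd (ncons x L) = x.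
Proof. by rewrite /nhd /= npairK. Qed.

Lemma ntl_cons x L : ntl (ncons x L) = L.
Proof. by rewrite /ntl /= npairK. Qed.

Lemma ntl0 : ntl 0 = 0.
Proof. by have := nsnd_le 0; rewrite /ntl /=; case: nsnd. Qed.

Lemma ncons_eta L : L <> 0 -> L = ncons (nhd L) (ntl L).
Proof. by case: L => // L _; rewrite /ncons /nhd /ntl /= npair_eta. Qed.

Lemma ncode_surj L : exists s, L = ncode s.
Proof.
elim/ltn_ind: L => -[|L] IH; first by exists [::].
have [|s Hs] := IH (ntl L.+1); first by have := nsnd_le L; rewrite /ntl /=; lia.
by exists (nhd L.+1 :: s); rewrite /= -Hs -ncons_eta.
Qed.

Lemma ndropS j L : ndrop j.+1 L = ndrop j (ntl L).
Proof. by elim: j => //= j; rewrite /= -/(ndrop _ _) => ->. Qed.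

Lemma ndrop_code j s : ndrop j (ncode s) = ncode (drop j s).
Proof.
elim: j s => [|j IH] [|x s] //; rewrite ndropS /= ?ntl_cons ?IH //.
by rewrite ntl0 (IH [::]).
Qed.

Lemma size_ncode s : size s <= ncode s.
Proof.
elim: s => //= x s; have := nsnd_le (npair x (ncode s)).
by rewrite npairK /ncons; lia.
Qed.

Lemma nnth_code s j : j < size s -> nnth (ncode s) j = nth 0 s j.
Proof.
by move=> js; rewrite /nnth ndrop_code (drop_nth 0 js) /= nhd_cons.
Qed.

Lemma nmem_code x s : nmem x (ncode s) <-> x \in s.
Proof.
split=> [[j [+ ->]]|/(nthP 0)[j js <-]].
  rewrite ndrop_code; case: (ltnP j (size s)) => js; last by rewrite drop_oversize.
  by move=> _; rewrite nnth_code // mem_nth.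
by exists j; rewrite ndrop_code nnth_code // (drop_nth 0 js).
Qed.

(** A code bounds the length of its list. Quantifiers over positions can thus be bounded by the code
    itself, which makes them admissible for [re_all_lt]. *)
Lemma ndrop_ge j L : L <= j -> ndrop j L = 0.
Proof.
have [s ->] := ncode_surj L; have := size_ncode s => h1 h2.
by rewrite ndrop_code drop_oversize //; lia.
Qed.

Lemma nnth_finite (f : nat -> nat) n : exists L, forall j, j < n -> nnth L j = f j.
Proof.
exists (ncode (mkseq f n)) => j jn.
by rewrite nnth_code ?size_mkseq // nth_mkseq.
Qed.

Section ReLists.
Implicit Types a b : set nat -> nat -> nat.

Lemma comp_tl a : comp a -> comp (fun O x => ntl (a O x)).
Proof. by rewrite /ntl => Ca; comp_tac. Qed.

Lemma comp_drop a b : comp a -> comp b -> comp (fun O x => ndrop (a O x) (b O x)).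
Proof.
move=> Ca Cb; apply: (@comp_rec _ (fun _ _ _ r => ntl r)) => //.
by apply: comp_tl; comp_tac.
Qed.

Lemma comp_nth a b : comp a -> comp b -> comp (fun O x => nnth (a O x) (b O x)).
Proof.
by move=> Ca Cb; rewrite /nnth /nhd; apply: comp_fst; apply: comp_pred; apply: comp_drop.
Qed.

Lemma re_mem a b : comp a -> comp b -> re (fun O x => nmem (a O x) (b O x)).
Proof.
move=> Ca Cb; apply: re_ex; apply: re_and; [apply: re_neq|apply: re_eq].
- by apply: comp_drop; comp_tac.
- by comp_tac.
- by comp_tac.
- by apply: comp_nth; comp_tac.
Qed.

Lemma re_all_mem (R : set nat -> nat -> nat -> Prop) b :
  comp b -> re (fun O x => R O (nfst x) (nsnd x)) ->
  re (fun O x => forall y, nmem y (b O x) -> R O x y).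
Proof.
move=> Cb HR.
apply: (@re_ext (fun O x => forall j, j < b O x ->
  ndrop j (b O x) = 0 \/ R O x (nnth (b O x) j))).
  move=> O x; split=> [h y [j [j0 ->]]|h j _].
    have [/h[]//|/ndrop_ge] := ltnP j (b O x); by move/j0.
  by have [->|/eqP j0] := eqVneq (ndrop j (b O x)) 0; [left|right; apply: h; exists j].
apply: re_all_lt => //; apply: re_or.
  by apply: re_eq0; apply: comp_drop; comp_tac.
have := re_subst HR (a := fun O x =>
  npair (nfst x) (nnth (b O (nfst x)) (nsnd x))).
have C : comp (fun O x => npair (nfst x) (nnth (b O (nfst x)) (nsnd x))).
  by apply: comp_pair; [comp_tac|apply: comp_nth; comp_tac].
by move=> /(_ C); apply: re_ext => O x; rewrite !npairK.
Qed.

Lemma re_memN a b : comp a -> comp b -> re (fun O x => ~ nmem (a O x) (b O x)).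
Proof.
move=> Ca Cb.
apply: (@re_ext (fun O x => forall y, nmem y (b O x) -> y <> a O x)).
  by move=> O x; split=> [h /h//|h y hy e]; apply: h; rewrite -e.
by apply: re_all_mem => //; re_tac.
Qed.

End ReLists.

Ltac comp_ext_tac ::=
  lazymatch goal with
  | |- comp (fun O x => (@?a O x).-1) => apply (@comp_pred a); comp_tac
  | |- comp (fun O x => @?a O x + @?b O x) => apply (@comp_add a b); comp_tac
  | |- comp (fun O x => @?a O x - @?b O x) => apply (@comp_sub a b); comp_tac
  | |- comp (fun O x => @?a O x * @?b O x) => apply (@comp_mul a b); comp_tac
  | |- comp (fun O x => minn (@?a O x) (@?b O x)) => apply (@comp_min a b); comp_tac
  | |- comp (fun O x => maxn (@?a O x) (@?b O x)) => apply (@comp_max a b); comp_tac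
  | |- comp (fun O x => ntl (@?a O x)) => apply (@comp_tl a); comp_tac
  | |- comp (fun O x => ndrop (@?a O x) (@?b O x)) =>
      apply (@comp_drop a b); comp_tac
  | |- comp (fun O x => nnth (@?a O x) (@?b O x)) => apply (@comp_nth a b); comp_tac
  | |- comp (fun O x => ?f O (@?a O x)) => apply (@comp_comp f a); comp_tac
  end.

Ltac re_ext_tac ::=
  lazymatch goal with
  | |- re (fun O x => nmem (@?a O x) (@?b O x)) => apply (@re_mem a b); comp_tac
  | |- re (fun O x => ~ nmem (@?a O x) (@?b O x)) => apply (@re_memN a b); comp_tac
  | |- re (fun O x => forall y, nmem y (@?b O x) -> @?R O x y) =>
      apply (@re_all_mem R b); [comp_tac | re_tac]
  end.

(** * The universal relation *)

Section Eval.
Variable O : set nat.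

(* The generated principle gives no hypothesis inside the premise of [eval_mu]. *)
Lemma eval_nested_ind (P : code -> nat -> nat -> Prop) :
  (forall x, P CZero x 0) ->
  (forall x, P CSucc x x.+1) ->
  (forall x y, P CFst (npair x y) x) ->
  (forall x y, P CSnd (npair x y) y) ->
  (forall x, O x -> P COracle x 1) ->
  (forall x, ~ O x -> P COracle x 0) ->
  (forall f g x y z, P f x y -> P g x z -> P (CPair f g) x (npair y z)) ->
  (forall f g x y z, P g x y -> P f y z -> P (CComp f g) x z) ->
  (forall f g x y, P f x y -> P (CPrec f g) (npair x 0) y) ->
  (forall f g x n y z, P (CPrec f g) (npair x n) y ->
     P g (npair x (npair n y)) z -> P (CPrec f g) (npair x n.+1) z) ->
  (forall f x n, (forall m, m < n -> exists y, P f (npair x m) y.+1) ->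
     P f (npair x n) 0 -> P (CMu f) x n) ->
  forall c x y, eval O c x y -> P c x y.
Proof.
move=> h0 h1 h2 h3 h4 h5 h6 h7 h8 h9 h10; fix IH 4 => c x y; case=> {c x y};
  try by [apply: h0|apply: h1|apply: h2|apply: h3|apply: h4|apply: h5].
- by move=> f g x y z /IH p /IH q; apply: h6.
- by move=> f g x y z /IH p /IH q; apply: h7 p q.
- by move=> f g x y /IH; apply: h8.
- by move=> f g x n y z /IH p /IH q; apply: h9 p q.
- move=> f x n hm /IH q; apply: h10 q => m /hm[y hy]; exists y; exact: IH.
Qed.

Ltac npair_inj_tac :=
  match goal with e : npair _ _ = npair _ _ |- _ =>
    move/npair_inj: e => [? ?]
  end.

Lemma eval_fun c x y y' : eval O c x y -> eval O c x y' -> y = y'.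
Proof.
move=> h; elim/eval_nested_ind: h y' => {c x y}.
- by move=> x y' h; inversion h.
- by move=> x y' h; inversion h.
- by move=> x y y' h; inversion h; npair_inj_tac; congruence.
- by move=> x y y' h; inversion h; npair_inj_tac; congruence.
- by move=> x Ox y' h; inversion h.
- by move=> x Ox y' h; inversion h.
- by move=> f g x y z IH1 IH2 y' h; inversion h; subst; congr npair; auto.
- move=> f g x y z IH1 IH2 y' h; inversion h as [| | | | | | |? ? ? w ? h1 h2| | |]; subst.
  by apply: IH2; rewrite (IH1 _ h1).
- by move=> f g x y IH y' h; inversion h; npair_inj_tac; subst => //; apply: IH.
- move=> f g x n y z IH1 IH2 y'; move Ew : (npair x n.+1) => w h.
  inversion h; subst w; npair_inj_tac => //.
  match goal with e : _.+1 = _.+1 |- _ => case: e => e end; subst.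
  match goal with e : eval _ (CPrec _ _) _ _ |- _ => move: (IH1 _ e) => ? end; subst.
  by apply: IH2.
- move=> f x n IHm IH0 y' h; inversion h as [| | | | | | | | | |? ? ? h1 h2]; subst.
  have [lt|lt|//] := ltngtP n y'.
    by have [y hy] := h1 _ lt; have := IH0 _ hy.
  by have [y /(_ _ h2)] := IHm _ lt.
Qed.

End Eval.

Definition ntriple (c x y : nat) : nat := npair c (npair x y).

(** One disjunct per rule of [eval], with the premises looked up in the list [T]. The clause for
    [COracle] only allows the answer 0, since the programs describing a graph run with the empty
    oracle. *)
Definition justified (T c x y : nat) : Prop :=
  (c = npair 0 0 /\ y = 0) \/ (c = npair 1 0 /\ y = x.+1) \/
  (c = npair 2 0 /\ y = nfst x) \/ (c = npair 3 0 /\ y = nsnd x) \/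
  (c = npair 4 0 /\ y = 0) \/
  (exists f, exists g, c = npair 5 (npair f g) /\
     nmem (ntriple f x (nfst y)) T /\ nmem (ntriple g x (nsnd y)) T) \/
  (exists f, exists g, exists a, c = npair 6 (npair f g) /\
     nmem (ntriple g x a) T /\ nmem (ntriple f a y) T) \/
  (exists f, exists g, exists a, c = npair 7 (npair f g) /\
     x = npair a 0 /\ nmem (ntriple f a y) T) \/
  (exists f, exists g, exists a, exists n, exists b, c = npair 7 (npair f g) /\
     x = npair a n.+1 /\ nmem (ntriple c (npair a n) b) T /\
     nmem (ntriple g (npair a (npair n b)) y) T) \/
  (exists f, c = npair 8 f /\ nmem (ntriple f (npair x y) 0) T /\
     forall m, m < y -> exists b, nmem (ntriple f (npair x m) b.+1) T).

(** Premises must occur strictly later in the list, in [ndrop j.+1 L]; this rules out circular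
    justifications. *)
Definition derivation (L : nat) : Prop :=
  forall j, j < L -> ndrop j L = 0 \/
    justified (ndrop j.+1 L) (nfst (nnth L j)) (nfst (nsnd (nnth L j)))
      (nsnd (nsnd (nnth L j))).

Definition univ (c x y : nat) : Prop :=
  exists L, derivation L /\ nmem (ntriple c x y) L.

Lemma re_univ (a b c : set nat -> nat -> nat) :
  comp a -> comp b -> comp c -> re (fun O x => univ (a O x) (b O x) (c O x)).
Proof. by move=> Ca Cb Cc; rewrite /univ /derivation /justified /ntriple; re_tac. Qed.

Lemma justifiedW (S T c x y : nat) : (forall t, nmem t S -> nmem t T) ->
  justified S c x y -> justified T c x y.
Proof.
move=> ST; rewrite /justified; do 5 (move=> [|]; first by auto 12).
case=> [[f [g [? [/ST ? /ST ?]]]]|]; first by do 5 right; left; exists f, g.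
case=> [[f [g [a [? [/ST ? /ST ?]]]]]|]; first by do 6 right; left; exists f, g, a.
case=> [[f [g [a [? [? /ST ?]]]]]|]; first by do 7 right; left; exists f, g, a.
case=> [[f [g [a [n [b [? [? [/ST ? /ST ?]]]]]]]]|].
  by do 8 right; left; exists f, g, a, n, b.
case=> f [? [/ST ? h]]; do 9 right; exists f; split=> //; split=> // m /h[b /ST ?].
by exists b.
Qed.

Definition justified_code T t := justified T (nfst t) (nfst (nsnd t)) (nsnd (nsnd t)).

Lemma derivation_cons t L :
  derivation (ncons t L) <-> justified_code L t /\ derivation L.
Proof.
have E M : derivation M <-> forall j,
    ndrop j M = 0 \/ justified_code (ndrop j.+1 M) (nnth M j).
  split=> h j; last by move=> _; apply: h.
  by have [/h//|/ndrop_ge ->] := ltnP j M; left.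
rewrite !E; split=> [h|[h1 h2] [|j]].
- split; first by have [//|] := h 0; rewrite /nnth /= nhd_cons ntl_cons.
  by move=> j; have := h j.+1; rewrite /nnth !(@ndropS _ (ncons _ _)) ntl_cons.
- by right; rewrite /nnth /= nhd_cons ntl_cons.
- by rewrite /nnth !(@ndropS _ (ncons _ _)) ntl_cons; apply: h2.
Qed.

(** Appending [t] only enlarges the tail in which a triple of [s] finds its premises. *)
Lemma derivation_cat s t :
  derivation (ncode s) -> derivation (ncode t) -> derivation (ncode (s ++ t)).
Proof.
elim: s => //= x s IH /derivation_cons[h1 h2] h3.
apply/derivation_cons; split; last exact: IH.
by apply: justifiedW h1 => z /nmem_code zs; apply/nmem_code; rewrite mem_cat zs.
Qed.

(** Induction on the list: the premises of the head lie in the tail. The numerical tag of the rule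
    determines the head constructor of [c]. *)
Lemma derivation_sound L c x y : derivation L ->
  nmem (ntriple (code_num c) x y) L -> eval set0 c x y.
Proof.
have [s ->] := ncode_surj L.
elim: s c x y => [|t s IH] c x y; first by move=> _ /nmem_code.
move=> /derivation_cons[jt ds] /nmem_code; rewrite inE.
case/orP=> [/eqP e|/nmem_code]; last exact: IH.
move: jt; rewrite /justified_code -e /ntriple !npairK -/ncode.
have IH' c' x' y' : nmem (ntriple (code_num c') x' y') (ncode s) -> eval set0 c' x' y'.
  by move=> h; apply: IH.
have N := npair_inj.
rewrite /justified; do 5 (move=> [[hc hy]|]; first by
  case: c hc {e} => [|||||c1 c2|c1 c2|c1 c2|c1] /= hc; case: (N _ _ _ _ hc) => // _ _;
  subst y; first [by constructor | by rewrite -{1}(npair_eta x); constructor]).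
case=> [[f [g [hc [h1 h2]]]]|].
  case: c hc {e} => [|||||c1 c2|c1 c2|c1 c2|c1] /= hc;
    move: (N _ _ _ _ hc) => [] // _ /N[? ?]; subst.
  by rewrite -(npair_eta y); apply: eval_pair; apply: IH'.
case=> [[f [g [a [hc [h1 h2]]]]]|].
  case: c hc {e} => [|||||c1 c2|c1 c2|c1 c2|c1] /= hc;
    move: (N _ _ _ _ hc) => [] // _ /N[? ?]; subst.
  by apply: eval_comp (IH' _ _ _ h1) (IH' _ _ _ h2).
case=> [[f [g [a [hc [hx h2]]]]]|].
  case: c hc {e} => [|||||c1 c2|c1 c2|c1 c2|c1] /= hc;
    move: (N _ _ _ _ hc) => [] // _ /N[? ?]; subst.
  by apply: eval_prec0; apply: IH'.
case=> [[f [g [a [n [b [hc [hx [h1 h2]]]]]]]]|].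
  case: c hc h1 {e} => [|||||c1 c2|c1 c2|c1 c2|c1] /= hc h1;
    move: (N _ _ _ _ hc) => [] // _ /N[? ?]; subst.
  by apply: eval_precS (IH' (CPrec c1 c2) _ _ h1) (IH' _ _ _ h2).
case=> f [hc [h1 h2]].
case: c hc {e} => [|||||c1 c2|c1 c2|c1 c2|c1] /= hc;
  move: (N _ _ _ _ hc) => [] // _ ?; subst.
apply: eval_mu (IH' _ _ _ h1) => m /h2[b hb]; exists b; exact: IH'.
Qed.

Lemma derivation_complete c x y : eval set0 c x y -> univ (code_num c) x y.
Proof.
have step s c' x' y' : derivation (ncode s) -> justified (ncode s) c' x' y' -> univ c' x' y'.
  move=> ds js; exists (ncode (ntriple c' x' y' :: s)); split; last first.
    by apply/nmem_code; rewrite inE eqxx.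
  by apply/derivation_cons; split=> //; rewrite /justified_code /ntriple !npairK.
have two c1 x1 y1 c2 x2 y2 : univ c1 x1 y1 -> univ c2 x2 y2 -> exists s,
  [/\ derivation (ncode s), nmem (ntriple c1 x1 y1) (ncode s) &
      nmem (ntriple c2 x2 y2) (ncode s)].
  move=> [L1 []] + + [L2 []]; have [s1 ->] := ncode_surj L1; have [s2 ->] := ncode_surj L2.
  move=> d1 /nmem_code m1 d2 /nmem_code m2; exists (s1 ++ s2); split.
  - exact: derivation_cat.
  - by apply/nmem_code; rewrite mem_cat m1.
  - by apply/nmem_code; rewrite mem_cat m2 orbT.
have d0 : derivation (ncode [::]) by move=> j.
move=> h; elim/eval_nested_ind: h => {c x y} //.
- by move=> x; apply: step d0 _; left.
- by move=> x; apply: step d0 _; right; left.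
- by move=> x y; apply: step d0 _; do 2 right; left; rewrite npairK.
- by move=> x y; apply: step d0 _; do 3 right; left; rewrite npairK.
- by move=> x _; apply: step d0 _; do 4 right; left.
- move=> f g x y z u1 u2; have [s [ds m1 m2]] := two _ _ _ _ _ _ u1 u2.
  apply: step ds _; do 5 right; left; exists (code_num f), (code_num g).
  by rewrite !npairK.
- move=> f g x y z u1 u2; have [s [ds m1 m2]] := two _ _ _ _ _ _ u1 u2.
  by apply: step ds _; do 6 right; left; exists (code_num f), (code_num g), y.
- move=> f g x y u1; have [s [ds m1 _]] := two _ _ _ _ _ _ u1 u1.
  by apply: step ds _; do 7 right; left; exists (code_num f), (code_num g), x.
- move=> f g x n y z u1 u2; have [s [ds m1 m2]] := two _ _ _ _ _ _ u1 u2.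
  by apply: step ds _; do 8 right; left; exists (code_num f), (code_num g), x, n, y.
- move=> f x n hm [L0 []]; have [s0 ->] := ncode_surj L0 => ds0 m0.
  (* The rule for [CMu] has a premise for each [m < n]; their derivations are concatenated into a
     single list. *)
  have [s ds ms] : exists2 s, derivation (ncode s) & forall m, m < n ->
      exists b, nmem (ntriple (code_num f) (npair x m) b.+1) (ncode s).
    elim: n hm {m0} => [|n IH] hm; first by exists [::].
    have [|s ds ms] := IH; first by move=> m mn; apply: hm; lia.
    have [y [L1 []]] := hm n (ltnSn n); have [s1 ->] := ncode_surj L1 => d1 m1.
    exists (s1 ++ s) => [|m mn]; first exact: derivation_cat.
    have [->|mn'] := eqVneq m n.
      by exists y; apply/nmem_code; rewrite mem_cat (proj1 (nmem_code _ _) m1).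
    have [|b /nmem_code mb] := ms m; first lia.
    by exists b; apply/nmem_code; rewrite mem_cat mb orbT.
  apply: (step (s0 ++ s)); first exact: derivation_cat.
  do 9 right; exists (code_num f); split=> //; split.
    by apply/nmem_code; rewrite mem_cat (proj1 (nmem_code _ _) m0).
  move=> m /ms[b /nmem_code mb]; exists b.
  by apply/nmem_code; rewrite mem_cat mb orbT.
Qed.

Lemma univP c x y : univ (code_num c) x y <-> eval set0 c x y.
Proof.
by split=> [[L [dL mL]]|]; [apply: derivation_sound dL mL|apply: derivation_complete].
Qed.

(** * Infinite components after the deletion of finitely many edges *)

Local Open Scope card_scope.

Section Components.
Variable G : graph.
Implicit Types (E F H : set (nat * nat)) (K Z : set nat).

(** This relates arbitrary numbers, not just vertices of [delete_edges G E]. The additional points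
    have singleton classes, so the infinite classes are the same. *)
Definition conn E : nat -> nat -> Prop := clos_refl_trans nat (del_adj G E).
Definition inf_comp E (v : nat) : Prop := infinite_set (conn E v).
Definition endpoint F (x : nat) : Prop := exists y, adj G x y /\ F (edge x y).

Lemma edgeC u v : edge u v = edge v u.
Proof. by rewrite /edge minnC maxnC. Qed.

Lemma adj_vertr u v : adj G u v -> vert G v.
Proof. by move/adj_sym/adj_vert. Qed.

Lemma conn_refl E u : conn E u u. Proof. exact: rt_refl. Qed.

Lemma conn_trans E v u w : conn E u v -> conn E v w -> conn E u w.
Proof. exact: rt_trans. Qed.

Lemma conn_sym E u v : conn E u v -> conn E v u.
Proof.
elim=> [x y /del_adj_sym|x|x y z _ h1 _ h2]; [exact: rt_step|exact: rt_refl|].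
exact: conn_trans h2 h1.
Qed.

Lemma connW E F u v : E `<=` F -> conn F u v -> conn E u v.
Proof.
move=> EF; elim=> [x y [xy h]|x|x y z _ h1 _ h2]; [|exact: rt_refl|exact: rt_trans h1 h2].
by apply: rt_step; split=> // /EF.
Qed.

Lemma conn_stable E Z u v :
  (forall x y, Z x -> del_adj G E x y -> Z y) -> Z u -> conn E u v -> Z v.
Proof.
move=> hZ Zu; elim/clos_refl_trans_ind_left => // x y _ Zx xy; exact: hZ Zx xy.
Qed.

Lemma conn_isolated E u v :
  (forall y, adj G u y -> E (edge u y)) -> conn E u v -> v = u.
Proof.
move=> hu; apply: (@conn_stable E (eq^~ u)) => // x y -> [uy]; by move/hu: uy.
Qed.

Lemma inf_comp_vert E v : inf_comp E v -> vert G v.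
Proof.
move=> hv; apply: contrapT => nv; apply: hv.
apply: (@sub_finite_set _ _ [set v]); last exact: finite_set1.
by move=> w /conn_isolated-> // y /adj_vert.
Qed.

Lemma inf_comp_conn E u v : conn E u v -> inf_comp E u -> inf_comp E v.
Proof.
move=> uv hu hv; apply: hu; apply: sub_finite_set hv => w; exact: conn_trans (conn_sym uv).
Qed.

Lemma inf_compW E F v : E `<=` F -> inf_comp F v -> inf_comp E v.
Proof. by move=> EF hv fE; apply: hv; apply: sub_finite_set fE => w; apply: connW. Qed.

Lemma not_inf_isolated E v :
  (forall y, adj G v y -> E (edge v y)) -> ~ inf_comp E v.
Proof.
move=> hv; apply; apply: (@sub_finite_set _ _ [set v]); last exact: finite_set1.
by move=> w /conn_isolated->.
Qed.

Lemma endpoint_vert F x : endpoint F x -> vert G x.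
Proof. by case=> y [/adj_vert]. Qed.

Lemma finite_endpoint F : finite_set F -> finite_set (endpoint F).
Proof.
move=> fF; apply: (@sub_finite_set _ _ ((fst @` F) `|` (snd @` F))).
  move=> x [y [_ h]].
  have [xy|xy] := leqP x y; [left|right]; exists (edge x y) => //=; lia.
by rewrite finite_setU; split; apply: finite_image.
Qed.

(* Cut a walk avoiding [E] at the last edge of [F] that it uses. *)
Lemma conn_last E F u w : conn E u w ->
  exists e, [/\ e = u \/ endpoint F e, conn E u e & conn F e w].
Proof.
elim/clos_refl_trans_ind_left => [|x y ux [e [he ue ex]] xy].
  by exists u; split; [left|apply: conn_refl|apply: conn_refl].
have [Fxy|nF] := pselect (F (edge x y)).
  exists y; split; last exact: conn_refl.
    by right; exists x; rewrite edgeC; split=> //; apply: adj_sym; case: xy.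
  by apply: conn_trans ux _; apply: rt_step.
exists e; split=> //; apply: conn_trans ex _; apply: rt_step.
by split=> //; case: xy.
Qed.

(** By [conn_last], every point of the component of [v] shares its component of [G] minus [F] with
    [v] or with an endpoint of [F]. These are finitely many pieces covering an infinite set, so one
    of them is infinite. *)
Lemma inf_comp_refine E F v : finite_set F -> inf_comp E v ->
  exists w, conn E v w /\ inf_comp F w.
Proof.
move=> fF hv; apply: contrapT => nw; apply: hv.
pose D := [set e | (e = v \/ endpoint F e) /\ conn E v e].
apply: (@sub_finite_set _ _ (\bigcup_(e in D) conn F e)).
  by move=> w /(@conn_last E F)[e [he ve ew]]; exists e.
apply: bigcup_finite.
  apply: (@sub_finite_set _ _ (v |` endpoint F)).
    by move=> e [[->|]]; [left|right].
  by rewrite finite_setU; split; [exact: finite_set1|exact: finite_endpoint].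
move=> e [_ ve]; apply: contrapT => he; apply: nw; by exists e.
Qed.

Definition atleast E m : Prop := exists v : nat -> nat, forall i, i < m ->
  inf_comp E (v i) /\ forall j, j < i -> ~ conn E (v i) (v j).

Lemma conn_comp E u v : conn E u v ->
  component (delete_edges G E) u = component (delete_edges G E) v.
Proof.
move=> uv; apply/seteqP; split=> w; first exact: conn_trans (conn_sym uv).
exact: conn_trans uv.
Qed.

Lemma inf_components_atleast E m :
  `I_m #<= inf_components (delete_edges G E) <-> atleast E m.
Proof.
split=> [/pcard_leP[f]|[v hv]].
  have /choice[v hv] : forall i, exists v, i < m -> f i = component (delete_edges G E) v.
    move=> i; case: (ltnP i m) => im; last by exists 0.
    have : inf_components (delete_edges G E) (f i) by apply: funS.
    by case=> -[v _ <-] _; exists v.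
  exists v => i im; split.
    have [_] : inf_components (delete_edges G E) (f i) by apply: funS.
    by rewrite hv.
  move=> j ji /conn_comp; have jm := ltn_trans ji im.
  rewrite -hv // -hv // => /(@inj _ _ _ f); rewrite !inE => /(_ im jm) e.
  by rewrite e ltnn in ji.
pose f i := component (delete_edges G E) (v i).
have finj : {in `I_m &, injective f}.
  move=> i j; rewrite !inE /= => im jm e.
  have ij : conn E (v i) (v j).
    by change (f i (v j)); rewrite e; apply: conn_refl.
  have [lt|lt|//] := ltngtP i j.
    by have [_ /(_ _ lt)] := hv _ jm; move/conn_sym: ij.
  by have [_ /(_ _ lt)] := hv _ im.
have /card_le_eql <- := inj_card_eq finj.
apply: subset_card_le => _ [i /= im <-]; have [hi _] := hv i im; split=> //.
(* A vertex with no remaining edge would have a singleton class, so [v i] does belong to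
   [del_vert]. *)
exists (v i) => //; apply: contrapT => nv; apply: (@not_inf_isolated E (v i)) => // y viy.
by apply: contrapT => nE; apply: nv; exists y.
Qed.

Lemma inf_components_bound E m :
  inf_components (delete_edges G E) #<= `I_m <-> ~ atleast E m.+1.
Proof.
split=> [h /inf_components_atleast h'|h].
  by have := card_le_trans h' h; rewrite card_le_II ltnn.
have [/finite_setP[n An]|] := pselect (finite_set (inf_components (delete_edges G E))).
  rewrite (card_le_eql An) card_le_II leqNgt; apply/negP => mn; apply: h.
  by apply/inf_components_atleast; rewrite (card_le_eqr An) card_le_II.
move=> /infiniteP hi; case: h; apply/inf_components_atleast.
by apply: card_le_trans hi; apply: subset_card_le.
Qed.

Lemma atleastW E m n : m <= n -> atleast E n -> atleast E m.
Proof. by move=> mn [v hv]; exists v => i im; apply: hv; apply: leq_trans mn. Qed.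

(** A finite supremum of naturals is attained: otherwise its predecessor would be a bound. For zero
    ends the empty edge set serves as witness. *)
Lemma number_of_endsP k : number_of_ends G k ->
  (forall E, finite_edge_set G E -> ~ atleast E k.+1) /\
  exists2 E, finite_edge_set G E & atleast E k.
Proof.
move=> [bk mink]; split=> [E fE|]; first exact/inf_components_bound/bk.
case: k bk mink => [|k] bk mink.
  exists set0; last by exists id.
  by split; [exact: finite_set0|move=> ?].
apply: contrapT => nE; suff /mink : ends_bound G k by rewrite ltnn.
by move=> E fE; apply/inf_components_bound => hE; apply: nE; exists E.
Qed.

Lemma number_of_ends_uniq k k' : number_of_ends G k -> number_of_ends G k' -> k = k'.
Proof. by move=> [b m] [b' m']; apply/eqP; rewrite eqn_leq m // m'. Qed.

Lemma SepP E : Sep G E <-> finite_edge_set G E /\ atleast E 2.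
Proof. by rewrite -inf_components_atleast. Qed.

Lemma SepMaxP k E : number_of_ends G k ->
  SepMax G E <-> finite_edge_set G E /\ atleast E k.
Proof.
move=> hk; split=> [[fE [k' [hk' /card_eqPle[_ h]]]]|[fE h]].
  by split=> //; rewrite (number_of_ends_uniq hk hk'); apply/inf_components_atleast.
split=> //; exists k; split=> //; apply/card_eqPle; split.
  by case: hk => + _; apply.
exact/inf_components_atleast.
Qed.

(** Deleting finitely many more edges splits each infinite component without destroying it, and
    never joins two of them. *)
Lemma atleast_refine E F m : finite_set F -> E `<=` F -> atleast E m -> atleast F m.
Proof.
move=> fF EF [v hv].
have /choice[w hw] : forall i, exists w, i < m -> conn E (v i) w /\ inf_comp F w.
  move=> i; case: (ltnP i m) => im; last by exists 0.
  by have [w hw] := inf_comp_refine fF (proj1 (hv i im)); exists w.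
exists w => i im; have [iw hwi] := hw i im; split=> // j ji /(connW EF) wij.
have [jw _] := hw j (ltn_trans ji im); have [_ /(_ _ ji)] := hv i im; apply.
by apply: conn_trans iw _; apply: conn_trans wij _; apply: conn_sym.
Qed.

Lemma conn_pigeonhole E m (w : nat -> nat) (T : seq nat) :
  (forall i, i < m -> forall j, j < i -> ~ conn E (w i) (w j)) ->
  (forall i, i < m -> exists2 t, t \in T & conn E (w i) t) -> m <= size T.
Proof.
move=> hw hT.
have /choice[f hf] : forall i, exists t, i < m -> t \in T /\ conn E (w i) t.
  move=> i; case: (ltnP i m) => im; last by exists 0.
  by have [t tT it] := hT i im; exists t.
have U : uniq (map f (iota 0 m)).
  rewrite map_inj_in_uniq ?iota_uniq // => i j; rewrite !mem_iota /= => im jm e.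
  have [_ ii] := hf i im; have [_ jj] := hf j jm.
  have ij : conn E (w i) (w j) by apply: conn_trans ii _; rewrite e; apply: conn_sym.
  have [lt|lt|//] := ltngtP i j; last by case: (hw _ im _ lt).
  by case: (hw _ jm _ lt); apply: conn_sym.
have /(uniq_leq_size U) : {subset map f (iota 0 m) <= T}.
  by move=> _ /mapP[i + ->]; rewrite mem_iota => /= /hf[].
by rewrite size_map size_iota.
Qed.

End Components.

(** * Frames *)

Section Frames.
Variable G : graph.
Hypothesis conG : connected G.
Implicit Types (E F H s : set (nat * nat)) (K Z M : set nat) (v : nat -> nat).

(* Deleting [F] isolates the vertices of [K]; every other component of [G] minus [F]
   contains some [v l], but the [v l] may share components or lie in finite ones:
   excluding this is [good]. *)
Record frame K F v m : Prop := Frame {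
  frame_fin : finite_edge_set G F;
  frame_inc : forall x y, K x -> adj G x y -> F (edge x y);
  frame_pos : 0 < m;
  frame_vert : forall i, i < m -> vert G (v i);
  frame_cover : forall x, endpoint G F x ->
    K x \/ exists2 l, l < m & conn G F x (v l) }.

Definition good F v m : Prop := forall i, i < m ->
  inf_comp G F (v i) /\ forall j, j < m -> j <> i -> ~ conn G F (v i) (v j).

Lemma conn_set0 u w : vert G u -> vert G w -> conn G set0 u w.
Proof.
move=> hu hw; elim: (conG hu hw) => [x y xy|x|x y z _ h1 _ h2];
  [|exact: rt_refl|exact: rt_trans h1 h2].
by apply: rt_step; split.
Qed.

Lemma conn_endpoint F u w : vert G u -> vert G w ->
  exists2 e, e = u \/ endpoint G F e & conn G F e w.
Proof.
by move=> hu hw; have [e [he _ ew]] := conn_last F (conn_set0 hu hw); exists e.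
Qed.

(** * What a frame reveals about infinite components *)

Section OneFrame.
Variables (K : set nat) (F : set (nat * nat)) (v : nat -> nat) (m : nat).
Hypothesis fr : frame K F v m.

Lemma frame_inf w : inf_comp G F w -> exists2 l, l < m & conn G F w (v l).
Proof.
move=> iw; have m0 := frame_pos fr.
(* A walk of [G] from [v 0] to [w] is cut at its last edge of [F]. The endpoint reached is not in
   [K], whose vertices are isolated, so the cover supplies a representative. *)
have [e he ew] := conn_endpoint F (frame_vert fr m0) (inf_comp_vert iw).
case: he ew => [->|/(frame_cover fr)[Ke|[l lm el]]] ew.
- by exists 0 => //; apply: conn_sym.
- exfalso; apply: (@not_inf_isolated G F e) => [y|]; first exact: (frame_inc fr Ke).
  exact: inf_comp_conn (conn_sym ew) iw.
- by exists l => //; apply: conn_trans el; apply: conn_sym.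
Qed.

Lemma frame_inf_sub H w : H `<=` F -> inf_comp G H w ->
  exists l, [/\ l < m, conn G H w (v l) & inf_comp G F (v l)].
Proof.
move=> HF iw; have [w' [ww' iw']] := inf_comp_refine (proj1 (frame_fin fr)) iw.
have [l lm wl] := frame_inf iw'; exists l; split=> //; last exact: inf_comp_conn iw'.
by apply: conn_trans ww' _; apply: connW wl.
Qed.

Lemma frame_count H k : H `<=` F -> atleast G H k -> k <= m.
Proof.
move=> HF [w hw]; rewrite -(size_iota 0 m) -(size_map v).
apply: (@conn_pigeonhole G H _ w) => [i /hw[]//|i /hw[iw _]].
have [l [lm wl _]] := frame_inf_sub HF iw; exists (v l) => //.
by apply/mapP; exists l => //; rewrite mem_iota.
Qed.

Lemma frame_merged H i j : H `<=` F -> i < m -> j < i ->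
  conn G H (v i) (v j) -> ~ atleast G H m.
Proof.
move=> HF im ji ij [w hw].
have : m <= size (map v (rem i (iota 0 m))).
  apply: (@conn_pigeonhole G H _ w) => [a /hw[]//|a /hw[iw _]].
  have [l [lm wl _]] := frame_inf_sub HF iw.
  have mem x : x < m -> x <> i -> v x \in map v (rem i (iota 0 m)).
    move=> xm /eqP xi; apply/mapP; exists x => //.
    by rewrite (mem_rem_uniq _ (iota_uniq 0 m)) !inE xi mem_iota.
  have [e|li] := eqVneq l i; last by exists (v l) => //; apply: mem => //; apply/eqP.
  exists (v j); last by rewrite e in wl; apply: conn_trans wl ij.
  by apply: mem; lia.
by rewrite size_map size_rem ?mem_iota ?size_iota /=; lia.
Qed.

Definition zone (I : set nat) : set nat :=
  [set x | K x \/ exists i, [/\ I i, i < m & conn G F x (v i)]].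

Lemma zone_conn I x y : conn G F x y -> zone I x -> zone I y.
Proof.
move=> xy [Kx|[i [Ii im xi]]].
  suff -> : y = x by left.
  by apply: conn_isolated xy => z; apply: (frame_inc fr Kx).
by right; exists i; split=> //; apply: conn_trans xi; apply: conn_sym.
Qed.

(* Restoring edges of [F] inside one zone only joins components meeting it. *)
Lemma conn_zone I H x y :
  (forall a b, adj G a b -> F (edge a b) -> H (edge a b) \/ zone I a /\ zone I b) ->
  conn G H x y -> conn G F x y \/ zone I x /\ zone I y.
Proof.
move=> hI; elim/clos_refl_trans_ind_left => [|a b _ IH [ab nH]].
  by left; apply: conn_refl.
have [Fab|nF] := pselect (F (edge a b)).
  have [//|[za zb]] := hI _ _ ab Fab; right; split=> //.
  by case: IH => [xa|[]//]; apply: zone_conn za; apply: conn_sym.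
have ab' : conn G F a b by apply: rt_step.
case: IH => [xa|[zx za]]; first by left; apply: conn_trans xa ab'.
by right; split=> //; apply: zone_conn za.
Qed.

(** Passing from [F] to [H] must merge two of the [k] infinite components. Both meet the zone, and
    neither meets [K], so each is the component of [v i] or of [v j]; being different, they are
    exactly these two. *)
Lemma distinct_of_not_atleast H k i j :
  i < m -> j < m -> atleast G F k -> ~ atleast G H k -> H `<=` F ->
  (forall a b, adj G a b -> F (edge a b) ->
     H (edge a b) \/ zone [set i; j] a /\ zone [set i; j] b) ->
  [/\ inf_comp G F (v i), inf_comp G F (v j) & ~ conn G F (v i) (v j)].
Proof.
move=> im jm [w hw] nH HF hz; apply: contrapT => nij; apply: nH.
exists w => a am; have [ia wa] := hw a am; split=> [|b ba].
  exact: inf_compW ia.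
have [ib _] := hw b (ltn_trans ba am).
move=> /(conn_zone hz)[/(wa _ ba)//|[za zb]].
have inz x : inf_comp G F x -> zone [set i; j] x -> conn G F x (v i) \/ conn G F x (v j).
  move=> ix [Kx|[l [[->|->] _]]]; [|by left|by right].
  by exfalso; apply: (@not_inf_isolated G F x) => // y; apply: (frame_inc fr Kx).
have nab := wa _ ba; apply: nij.
have [ai|aj] := inz _ ia za; have [bi|bj] := inz _ ib zb.
- by case: nab; apply: conn_trans ai _; apply: conn_sym.
- split; [exact: inf_comp_conn ai ia|exact: inf_comp_conn bj ib|] => ij.
  by apply: nab; apply: conn_trans ai _; apply: conn_trans ij _; apply: conn_sym.
- split; [exact: inf_comp_conn bi ib|exact: inf_comp_conn aj ia|] => /conn_sym ij.
  by apply: nab; apply: conn_trans aj _; apply: conn_trans ij _; apply: conn_sym.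
- by case: nab; apply: conn_trans aj _; apply: conn_sym.
Qed.

Lemma distinct_of_Sep H i z : H `<=` F -> atleast G H 2 ->
  (forall j, j < m -> j <> i -> conn G H (v j) z) ->
  inf_comp G F (v i) /\ forall j, j < m -> j <> i -> ~ conn G F (v i) (v j).
Proof.
move=> HF [w hw] hz.
have [i1 /(_ 0 isT) w10] := hw 1 isT; have [i0 _] := hw 0 isT.
(* Here [b] is joined to [z] through some [v l] with [l <> i], so the component of [a] avoids [z]
   and its only possible representative is [v i]. Of the two given infinite components at least one
   can play the part of [b], since both cannot contain [v i]. *)
have main a b : inf_comp G H a -> inf_comp G H b -> ~ conn G H a b -> forall l,
    l < m -> conn G H b (v l) -> l <> i ->
  inf_comp G F (v i) /\ forall j, j < m -> j <> i -> ~ conn G F (v i) (v j).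
  move=> ia ib nab l lm bl li; have bz := conn_trans bl (hz l lm li).
  have [l' [lm' al' il']] := frame_inf_sub HF ia.
  have [e|/eqP l'i] := eqVneq l' i; last first.
    by case: nab; apply: conn_trans (conn_sym bz); apply: conn_trans al' (hz _ lm' l'i).
  subst l'; split=> // j jm ji /(connW HF) ij; apply: nab.
  apply: conn_trans al' _; apply: conn_trans ij _.
  by apply: conn_trans (hz _ jm ji) _; apply: conn_sym.
have [l [lm wl _]] := frame_inf_sub HF i0.
have [e|/eqP li] := eqVneq l i; last exact: main w10 _ lm wl li.
have [l' [lm' wl' _]] := frame_inf_sub HF i1.
apply: (main _ _ i0 i1 _ _ lm' wl') => [/conn_sym//|e'].
by apply: w10; apply: conn_trans wl' _; rewrite e' -e; apply: conn_sym.
Qed.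

Hypothesis gd : good F v m.

Lemma good_notK i : i < m -> ~ K (v i).
Proof.
move=> /gd[iv _] Kv; apply: (@not_inf_isolated G F (v i)) => // y.
exact: (frame_inc fr Kv).
Qed.

Lemma good_inj i j : i < m -> j < m -> conn G F (v i) (v j) -> i = j.
Proof.
by move=> im jm ij; have [//|/eqP ji] := eqVneq j i; have [_ /(_ j jm ji)] := gd im.
Qed.

Lemma good_atleast : atleast G F m.
Proof.
by exists v => i im; have [iv h] := gd im; split=> // j ji; apply: h; lia.
Qed.

(** For [s] inside [F], each infinite component of [G] minus [s] contains some [v l], and in a good
    frame each [v l] lies in an infinite one. Counting these components is thus a matter of
    connections between representatives. *)
Lemma good_Sep s : s `<=` F ->
  atleast G s 2 <-> exists i, exists j, [/\ i < m, j < i & ~ conn G s (v i) (v j)].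
Proof.
move=> sF; split=> [[w hw]|[i [j [im ji nij]]]].
  have [i1 /(_ 0 isT) w10] := hw 1 isT; have [i0 _] := hw 0 isT.
  have [l [lm wl _]] := frame_inf_sub sF i0; have [l' [lm' wl' _]] := frame_inf_sub sF i1.
  have nll : ~ conn G s (v l') (v l).
    move=> h; apply: w10; apply: conn_trans wl' _; apply: conn_trans h _.
    exact: conn_sym.
  have [lt|lt|e] := ltngtP l l'; [by exists l', l| |].
    by exists l, l'; split=> // /conn_sym.
  by case: nll; rewrite e; apply: conn_refl.
exists (fun a => if a == 0 then v j else v i) => -[|[|//]] _ /=; split=> //.
- by apply: inf_compW sF _; case: (gd (ltn_trans ji im)).
- by apply: inf_compW sF _; case: (gd im).
- by case.
Qed.

Lemma good_SepMax s : s `<=` F ->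
  atleast G s m <-> forall i, i < m -> forall j, j < i -> ~ conn G s (v i) (v j).
Proof.
move=> sF; split=> [hm i im j ji ij|h]; first exact: (@frame_merged s i j).
exists v => i im; split=> [|j ji]; last exact: h.
by apply: inf_compW sF _; case: (gd im).
Qed.

(* [M] is the trace on finitely many vertices of a union of components of [G]
   minus [s] that contains [v i] but not [v j]. *)
Definition colouring s M i j : Prop :=
  [/\ M (v i), ~ M (v j),
     forall x y, adj G x y -> F (edge x y) -> ~ s (edge x y) -> (M x <-> M y) &
     forall x, endpoint G F x -> K x \/
       exists l, [/\ l < m, conn G F x (v l) & M x <-> M (v l)]].

Lemma colouring_nconn s M i j : i < m -> j < m ->
  colouring s M i j -> ~ conn G s (v i) (v j).
Proof.
move=> im jm [Mi nMj hF hM] ij.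
(* [M] is informative only on endpoints of [F] and on representatives. [S] extends the colour to the
   whole of each component outside [K] by that of its representative, unique because the frame is
   good; it is then closed under the edges outside [s]. *)
pose S x := (K x /\ M x) \/ (~ K x /\ exists l, [/\ l < m, conn G F x (v l) & M (v l)]).
have : S (v j).
  apply: conn_stable ij; last first.
    by right; split; [exact: good_notK|exists i; split=> //; apply: conn_refl].
  move=> x y Sx [xy nsxy]; have yx := adj_sym xy.
  have [Fxy|nF] := pselect (F (edge x y)).
    have My : M y.
      apply/(hF _ _ xy Fxy nsxy); case: Sx => [[]//|[nK [l [lm xl Ml]]]].
      have [//|[l' [lm' xl' ->]]] := hM x (ex_intro _ y (conj xy Fxy)).
      by rewrite -(good_inj lm lm') //; apply: conn_trans xl'; apply: conn_sym.
    have [Ky|nKy] := pselect (K y); [by left|right; split=> //].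
    have ey : endpoint G F y by exists x; rewrite edgeC.
    have [//|[l' [lm' yl' e]]] := hM y ey.
    by exists l'; split=> //; apply/e.
  right; case: Sx => [[Kx _]|[nK [l [lm xl Ml]]]].
    by case: nF; apply: (frame_inc fr Kx xy).
  split=> [Ky|]; first by case: nF; rewrite edgeC; apply: (frame_inc fr Ky yx).
  exists l; split=> //; apply: conn_trans xl; apply: conn_sym.
  exact: rt_step.
case=> [[/(good_notK jm)]//|[_ [l [lm jl Ml]]]].
by apply: nMj; rewrite (good_inj jm lm jl).
Qed.

Lemma nconn_colouring s i j : s `<=` F -> i < m -> j < m ->
  ~ conn G s (v i) (v j) -> exists2 M, finite_set M & colouring s M i j.
Proof.
move=> sF im jm nij.
(* Restricting the component of [v i] to the finite set [D] keeps every vertex whose colour is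
   inspected. *)
pose D := [set x | endpoint G F x \/ exists2 l, l < m & x = v l].
exists [set x | D x /\ conn G s (v i) x].
  apply: (@sub_finite_set _ _ (endpoint G F `|` (v @` `I_m))).
    by move=> x [[ex|[l lm ->]] _]; [left|right; exists l].
  rewrite finite_setU; split; last by apply: finite_image; apply: finite_II.
  by apply: finite_endpoint; case: (frame_fin fr).
split=> /=.
- by split; [right; exists i|apply: conn_refl].
- by case.
- move=> x y xy Fxy nsxy; have yx := adj_sym xy.
  split=> -[_ h]; split.
  + by left; exists x; rewrite edgeC.
  + by apply: conn_trans h _; apply: rt_step.
  + by left; exists y.
  + by apply: conn_trans h _; apply: rt_step; split=> //; rewrite edgeC.
- move=> x ex; have [Kx|[l lm xl]] := frame_cover fr ex; [by left|right].
  exists l; split=> //; split=> -[_ h]; split.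
  + by right; exists l.
  + by apply: conn_trans h _; apply: connW xl.
  + by left.
  + by apply: conn_trans h _; apply: conn_sym; apply: connW xl.
Qed.

End OneFrame.

Definition linked K r : Prop := K r /\
  forall x, K x -> clos_refl_trans nat (fun a b => [/\ adj G a b, K a & K b]) r x.

(** The edges of [F] still deleted after those with both ends in [Z] have been restored. *)
Definition outside F Z : set (nat * nat) := [set e | F e /\ ~ (Z e.1 /\ Z e.2)].

Lemma outside_edge F Z a b :
  F (edge a b) -> outside F Z (edge a b) \/ Z a /\ Z b.
Proof.
move=> Fab; have [[za zb]|n] := pselect (Z a /\ Z b); [by right|left].
by split=> // -[]; rewrite /edge /=; have [ab|ab] := leqP a b => ? ?; apply: n.
Qed.

Lemma outside_edgeN F Z a b : Z a -> Z b -> ~ outside F Z (edge a b).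
Proof.
move=> za zb [_]; apply; rewrite /edge /=; by have [ab|ab] := leqP a b.
Qed.

(** * Restoring edges in a frame built on a connected set *)

Section Complete.
Variables (K : set nat) (F : set (nat * nat)) (v : nat -> nat) (m r : nat).
Hypotheses (fr : frame K F v m) (lk : linked K r) (rG : vert G r).
Hypothesis incK : forall x y, adj G x y -> F (edge x y) -> K x \/ K y.

Lemma linked_conn I x : zone K F v m I x -> vert G x ->
  conn G (outside F (zone K F v m I)) r x.
Proof.
move=> zx hx; set H := outside _ _.
have Kconn y : K y -> conn G H r y.
  move=> /(proj2 lk); elim=> {y} [a b [ab Ka Kb]|a|a b c _ h1 _ h2];
    [|exact: rt_refl|exact: rt_trans h1 h2].
  by apply: rt_step; split=> //; apply: outside_edgeN; left.
have HF : H `<=` F by move=> e [].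
have [e he ex] := conn_endpoint F rG hx.
apply: conn_trans (connW HF ex).
(* The last endpoint [e] of [F] before [x] shares the component of [x], hence lies in the zone. The
   edge of [F] at [e] has an end in [K], so either [e] is in [K] or a restored edge joins it to [K],
   which is connected to [r] from within. *)
have ze : zone K F v m I e by apply: zone_conn zx => //; apply: conn_sym.
have [->|[y [ey Fey]]] := he; first exact: conn_refl.
have [/Kconn//|Ky] := incK ey Fey.
apply: conn_trans (Kconn y Ky) _; apply: rt_step; split; first exact: adj_sym.
by apply: outside_edgeN => //; left.
Qed.

Lemma zone_self (I : set nat) i : I i -> i < m -> zone K F v m I (v i).
Proof. by move=> Ii im; right; exists i; split=> //; apply: conn_refl. Qed.

Lemma outside_not_atleast i j : i < m -> j < i ->
  ~ atleast G (outside F (zone K F v m [set i; j])) m.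
Proof.
move=> im ji; have jm := ltn_trans ji im.
apply: (frame_merged fr (i := i) (j := j)) => //; first by move=> e [].
apply: (@conn_trans _ _ r); [apply: conn_sym|]; apply: linked_conn.
- by apply: zone_self => //; left.
- exact: (frame_vert fr).
- by apply: zone_self => //; right.
- exact: (frame_vert fr).
Qed.

Lemma outside_Sep i : 1 < m -> good F v m -> i < m ->
  atleast G (outside F (zone K F v m [set j | j <> i])) 2.
Proof.
move=> m1 gd im; set H := outside _ _; have HF : H `<=` F by move=> e [].
have [j jm ji] : exists2 j, j < m & j <> i.
  by case: (eqVneq i 0) => [->|i0]; [exists 1|exists 0; lia].
(* The component of [v i] stays closed: a restored edge has both ends in the zone of the other
   indices, which does not meet that component. *)
have nij : ~ conn G H (v i) (v j).
  have [_ /(_ j jm ji) nij] := gd i im; move=> hij; apply: nij.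
  apply: conn_stable hij; last exact: conn_refl.
  move=> x y ix [xy nH].
  have xi := conn_sym ix.
  have [Fxy|nF] := pselect (F (edge x y)); last first.
    by apply: conn_trans ix _; apply: rt_step.
  have [//|[[Kx|[l [li lm xl]]] _]] := outside_edge (zone K F v m [set j | j <> i]) Fxy.
    case: (good_notK fr gd im); rewrite (conn_isolated _ xi) // => z.
    exact: (frame_inc fr Kx).
  by case: li; apply: (good_inj gd lm im); apply: conn_sym; apply: conn_trans ix xl.
exists (fun a => if a == 0 then v j else v i) => -[|[|//]] _ /=; split=> //.
- by apply: inf_compW HF _; case: (gd j jm).
- by apply: inf_compW HF _; case: (gd i im).
- by case.
Qed.

End Complete.

(** * Existence of good frames *)

Definition incident K : set (nat * nat) :=
  [set e | exists x y, [/\ K x, adj G x y & e = edge x y]].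

Lemma finite_incident K : locally_finite G -> finite_set K -> K `<=` vert G ->
  finite_edge_set G (incident K).
Proof.
move=> lf fK KG; split; last by move=> e [x [y [_ xy ->]]]; exists x, y.
apply: (@sub_finite_set _ _ (\bigcup_(x in K) (edge x @` neighbors G x))).
  by move=> e [x [y [Kx xy ->]]]; exists x => //; exists y.
by apply: bigcup_finite => // x /KG/lf; apply: finite_image.
Qed.

Lemma linked_sub K K' r x : K `<=` K' ->
  clos_refl_trans nat (fun a b => [/\ adj G a b, K a & K b]) r x ->
  clos_refl_trans nat (fun a b => [/\ adj G a b, K' a & K' b]) r x.
Proof.
move=> KK'; elim=> {x} [a b [ab Ka Kb]|a|a b c _ h1 _ h2];
  [|exact: rt_refl|exact: rt_trans h1 h2].
by apply: rt_step; split=> //; apply: KK'.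
Qed.

Lemma linkedU K K' r : linked K r -> linked K' r -> linked (K `|` K') r.
Proof.
move=> [Kr h] [_ h']; split; first by left.
by move=> x [/h|/h']; apply: linked_sub => y ?; [left|right].
Qed.

Lemma linked_vertex r x : vert G r -> vert G x ->
  exists K, [/\ finite_set K, K `<=` vert G, K x & linked K r].
Proof.
move=> rG xG; elim/clos_refl_trans_ind_left: (conG rG xG) => {xG x}.
  exists [set r]; split=> //; [by move=> x ->|split=> // x ->; exact: rt_refl].
move=> x y _ [K [fK KG Kx lK]] xy; exists (y |` K); split.
- by rewrite finite_setU; split.
- by move=> z [->|/KG//]; apply: adj_vertr xy.
- by left.
have [Kr hK] := lK; split; first by right.
have K' z : K z -> clos_refl_trans nat
    (fun a b => [/\ adj G a b, (y |` K) a & (y |` K) b]) r z.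
  by move=> /hK; apply: linked_sub => a; right.
move=> z [->|/K'//]; apply: rt_trans (K' _ Kx) _; apply: rt_step.
by split=> //; [right|left].
Qed.

Lemma linked_finite r A : vert G r -> finite_set A -> A `<=` vert G ->
  exists K, [/\ finite_set K, K `<=` vert G, A `<=` K & linked K r].
Proof.
move=> rG /finite_seqP[l ->]; elim: l => [|x l IH] lG.
  have [K [fK KG _ lK]] := linked_vertex rG rG; exists K; split=> //.
have [|K [fK KG lK lkK]] := IH.
  by move=> y yl; apply: lG; rewrite /= inE [_ \in _]yl orbT.
have xG : vert G x by apply: lG; rewrite /= inE eqxx.
have [K' [fK' KG' Kx' lk']] := linked_vertex rG xG.
exists (K `|` K'); split.
- by rewrite finite_setU.
- by move=> y [/KG|/KG'].
- by move=> y; rewrite /= inE => /orP[/eqP->|/lK]; [right|left].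
- exact: linkedU.
Qed.

(** A finite linked [K1] is chosen to contain the endpoints of [s] and of a set attaining [k].
    Removing the edges at [K1] may leave finite components besides the infinite ones; adding these
    to [K1] gives [K]. *)
Lemma frame_exists k s : locally_finite G -> number_of_ends G k -> 0 < k ->
  finite_edge_set G s -> exists K F v r,
  [/\ finite_set K, K `<=` vert G, s `<=` F & frame K F v k] /\
  [/\ good F v k, linked K r, vert G r &
      forall x y, adj G x y -> F (edge x y) -> K x \/ K y].
Proof.
move=> lf hk k0 [fs sG]; have [bk [F0 [fF0 F0G] [v0 hv0]]] := number_of_endsP hk.
pose r := v0 0; have rG : vert G r by have [/inf_comp_vert] := hv0 0 k0.
have [|x|K1 [fK1 K1G AK1 lk1]] := @linked_finite r (endpoint G F0 `|` endpoint G s) rG.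
- by rewrite finite_setU; split; apply: finite_endpoint.
- by case=> /endpoint_vert.
have incl S : S `<=` edges G -> endpoint G S `<=` K1 -> S `<=` incident K1.
  move=> SG SK e Se; have [x [y [xy exy]]] := SG e Se; exists x, y; split=> //.
  by apply: SK; exists y; rewrite -exy.
have F0F1 : F0 `<=` incident K1 by apply: incl => // x hx; apply: AK1; left.
have sF1 : s `<=` incident K1 by apply: incl => // x hx; apply: AK1; right.
have [fF1 F1G] := finite_incident lf fK1 K1G; set F1 := incident K1 in fF1 F1G F0F1 sF1 *.
have [v hv] : atleast G F1 k by apply: (atleast_refine fF1 F0F1); exists v0.
pose K := [set w | vert G w /\ ~ inf_comp G F1 w].
have K1K : K1 `<=` K.
  move=> x K1x; split; first exact: K1G.
  by apply: not_inf_isolated => y xy; exists x, y.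
(* Each component of [G] minus [F1] meets [r] or an endpoint of [F1], so [K] is a finite union of
   finite components. *)
have fK : finite_set K.
  pose D := [set e | (e = r \/ endpoint G F1 e) /\ ~ inf_comp G F1 e].
  apply: (@sub_finite_set _ _ (\bigcup_(e in D) conn G F1 e)).
    move=> w [wG iw]; have [e he ew] := conn_endpoint F1 rG wG; exists e => //.
    by split=> // ie; apply: iw; apply: inf_comp_conn ew ie.
  apply: bigcup_finite; last by move=> e [_ /contrapT].
  apply: (@sub_finite_set _ _ (r |` endpoint G F1)).
    by move=> e [[->|he] _]; [left|right].
  by rewrite finite_setU; split=> //; apply: finite_endpoint.
have KG : K `<=` vert G by move=> x [].
have [fF FG] := finite_incident lf fK KG; set F := incident K in fF FG *.
have F1F : F1 `<=` F by move=> e [x [y [/K1K Kx xy ->]]]; exists x, y.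
(* Infinite components of [G] minus [F1] do not meet [K], so deleting the edges at [K] leaves them
   intact. *)
have connF w u : inf_comp G F1 w -> conn G F1 w u -> conn G F w u.
  move=> iw; elim/clos_refl_trans_ind_left => [|a b wa IH [ab nab]]; first exact: conn_refl.
  apply: conn_trans IH _; apply: rt_step; split=> // -[x [y [[_ nx] xy e]]]; apply: nx.
  have wb : conn G F1 w b by apply: conn_trans wa _; apply: rt_step.
  have [->|->] : x = a \/ x = b by move: e; rewrite /edge => -[]; lia.
    exact: inf_comp_conn iw.
  exact: inf_comp_conn iw.
have infF w : inf_comp G F1 w -> inf_comp G F w.
  move=> iw fw; apply: (iw); apply: sub_finite_set fw => u; exact: connF.
(* A vertex of an absorbed finite component is reached from [K1] by one edge of [F1] followed by a
   walk inside that component, which is contained in [K]. *)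
have lkK : linked K r.
  have [K1r h1] := lk1; split; first exact: K1K.
  move=> x [xG ix]; have [e he ex] := conn_endpoint F1 rG xG.
  have ie : ~ inf_comp G F1 e by move=> ie; apply: ix; apply: inf_comp_conn ex ie.
  apply: (@rt_trans _ _ _ e).
    case: he => [->|[y [ey [a [b [K1a ab eab]]]]]]; first exact: rt_refl.
    have K1' z : K1 z -> _ := fun h => linked_sub K1K (h1 z h).
    have [<-|ay] : a = e \/ a = y by move: eab; rewrite /edge => -[]; lia.
      exact: K1'.
    subst a; apply: rt_trans (K1' _ K1a) _; apply: rt_step; split; first exact: adj_sym.
      exact: K1K.
    by split=> //; apply: adj_vert ey.
  elim/clos_refl_trans_ind_left: ex => [|a b ea IH [ab nab]]; first exact: rt_refl.
  apply: rt_trans IH _; apply: rt_step.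
  have eb : conn G F1 e b by apply: conn_trans ea _; apply: rt_step.
  split=> //; split; [exact: adj_vert ab| |exact: adj_vertr ab|].
    by move=> ia; apply: ie; apply: inf_comp_conn (conn_sym ea) ia.
  by move=> ib; apply: ie; apply: inf_comp_conn (conn_sym eb) ib.
exists K, F, v, r; split; split=> //.
- by move=> e /sF1/F1F.
- split=> //.
  + by move=> x y Kx xy; exists x, y.
  + by move=> i /hv[/inf_comp_vert].
  + move=> x ex; have xG := endpoint_vert ex.
    have [ix|nix] := pselect (inf_comp G F1 x); [right|by left].
    (* An endpoint in an infinite component missed by all [v l] would be a representative number
       [k.+1]. *)
    apply: contrapT => nl; apply: (bk F1) => //.
    exists (fun i => if i < k then v i else x) => i; rewrite ltnS leq_eqVlt.
    case: (ltnP i k) => ik /=.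
      move=> _; have [iv hi] := hv i ik; split=> // j ji.
      by rewrite (ltn_trans ji ik); apply: hi.
    rewrite orbF => /eqP e; split=> // j ji; rewrite e in ji; rewrite ji => xj.
    by apply: nl; exists j => //; apply: connF.
- move=> i im; have [iv hi] := hv i im; split=> [|j jm ji]; first exact: infF.
  move=> /(connW F1F) ij; have [lt|lt|e] := ltngtP i j; [|exact: (hi _ lt ij)|by case: ji].
  by have [_ /(_ _ lt)] := hv j jm; apply; apply: conn_sym.
- move=> x y xy [a [b [Ka ab e]]].
  have [<-|<-] : a = x \/ a = y by move: e; rewrite /edge => -[]; lia.
    by left.
  by right.
Qed.

End Frames.

(** * Certificates *)

(* Throughout, [D] is the number of a description, [K] and [M] code finite sets
   of vertices, [V] the sequence of representatives [v_0, ..., v_{m-1}], and [F],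
   [H], [s] finite sets of edges, an edge [(a, b)] being coded by [npair a b]. *)

Definition nedge (u v : nat) : nat := npair (minn u v) (maxn u v).

Definition cvert (D u : nat) : Prop := univ (nfst D) u 1.

(** The adjacency program is specified only on pairs of vertices, so its answer counts only once
    both vertex tests have succeeded. *)
Definition cadj (D u v : nat) : Prop :=
  cvert D u /\ cvert D v /\ univ (nfst (nsnd D)) (npair u v) 1.

Definition cadjN (D u v : nat) : Prop :=
  univ (nfst D) u 0 \/ univ (nfst D) v 0 \/
  (cvert D u /\ cvert D v /\ univ (nfst (nsnd D)) (npair u v) 0).

Definition cedge (D e : nat) : Prop :=
  nfst e < nsnd e /\ cadj D (nfst e) (nsnd e).

Definition cedgeN (D e : nat) : Prop :=
  nsnd e <= nfst e \/ cadjN D (nfst e) (nsnd e).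

Definition cconn (D F u v : nat) : Prop :=
  exists L, exists n, nnth L 0 = u /\ nnth L n = v /\ forall j, j < n ->
    cadj D (nnth L j) (nnth L j.+1) /\ ~ nmem (nedge (nnth L j) (nnth L j.+1)) F.

(* [L] lists as many distinct neighbours of [x] as its degree, hence all of them. *)
Definition cfull (D F x : nat) : Prop :=
  exists n, exists L, univ (nsnd (nsnd D)) x n /\ forall j, j < n ->
    cadj D x (nnth L j) /\ nmem (nedge x (nnth L j)) F /\
    forall i, i < j -> nnth L i <> nnth L j.

Definition ccover (D K F V m x : nat) : Prop :=
  nmem x K \/ exists l, l < m /\ cconn D F x (nnth V l).

Definition cframe (D K F V m : nat) : Prop :=
  0 < m /\ (forall i, i < m -> cvert D (nnth V i)) /\
  (forall e, nmem e F -> cedge D e /\ ccover D K F V m (nfst e) /\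
     ccover D K F V m (nsnd e)) /\
  (forall x, nmem x K -> cvert D x /\ cfull D F x).

Definition czone (D K F V i j x : nat) : Prop :=
  nmem x K \/ cconn D F x (nnth V i) \/ cconn D F x (nnth V j).

Definition csub (s F : nat) : Prop := forall e, nmem e s -> nmem e F.

(** [H] is guessed, not computed. Any subset of [F] outside [SepMax] serves, provided the edges of
    [F] missing from it have both ends in the zone of [i] and [j]. *)
Definition cert_SepMax (O : set nat) (D K F V m : nat) : Prop :=
  cframe D K F V m /\ O F /\ forall i, i < m -> forall j, j < i ->
    exists H, ~ O H /\ csub H F /\ forall e, nmem e F ->
      nmem e H \/ (czone D K F V i j (nfst e) /\ czone D K F V i j (nsnd e)).

(** The point [z] gathers all representatives but [v i] in one component, so of two infinite
    components one avoids [z]. The completeness proof takes for [z] the base point of [K]. *)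
Definition cert_Sep (O : set nat) (D K F V m : nat) : Prop :=
  cframe D K F V m /\ forall i, i < m -> exists H, exists z,
    O H /\ csub H F /\ forall j, j < m -> j = i \/ cconn D H (nnth V j) z.

Definition csame (M x y : nat) : Prop :=
  (nmem x M /\ nmem y M) \/ (~ nmem x M /\ ~ nmem y M).

Definition ccolour1 (D K F V m M x : nat) : Prop :=
  nmem x K \/
  exists l, l < m /\ cconn D F x (nnth V l) /\ csame M x (nnth V l).

Definition ccolour (D K F V m s M i j : nat) : Prop :=
  nmem (nnth V i) M /\ ~ nmem (nnth V j) M /\
  forall e, nmem e F -> (nmem e s \/ csame M (nfst e) (nsnd e)) /\
    ccolour1 D K F V m M (nfst e) /\ ccolour1 D K F V m M (nsnd e).

(** The query [O 0] asks whether there is at most one end, in which case nothing separates.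
    Otherwise yes is certified by a colouring for some pair of representatives, no by an invalid
    edge or by walks joining all pairs. *)
Definition sep_rel (O : set nat) (x y : nat) : Prop :=
  (y = 1 /\ ~ O 0 /\ (forall e, nmem e (nsnd x) -> cedge (nfst x) e) /\
   exists K, exists F, exists V, exists m, csub (nsnd x) F /\
     cert_SepMax O (nfst x) K F V m /\ exists i, i < m /\ exists j, j < i /\
     exists M, ccolour (nfst x) K F V m (nsnd x) M i j) \/
  (y = 0 /\ (O 0 \/ (exists e, nmem e (nsnd x) /\ cedgeN (nfst x) e) \/
   (~ O 0 /\ (forall e, nmem e (nsnd x) -> cedge (nfst x) e) /\
    exists K, exists F, exists V, exists m, csub (nsnd x) F /\
      cert_SepMax O (nfst x) K F V m /\ forall i, i < m -> forall j, j < i ->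
      cconn (nfst x) (nsnd x) (nnth V i) (nnth V j)))).

Definition ends_rel (O : set nat) (x y : nat) : Prop :=
  (O 0 /\ y = 1) \/
  (~ O 0 /\ exists K, exists F, exists V, cert_SepMax O x K F V y).

Definition sepmax_rel (O : set nat) (x y : nat) : Prop :=
  (y = 1 /\ (forall e, nmem e (nsnd (nsnd x)) -> cedge (nfst x) e) /\
   (nfst (nsnd x) <= 1 \/ (1 < nfst (nsnd x) /\
    exists K, exists F, exists V, csub (nsnd (nsnd x)) F /\
      cert_Sep O (nfst x) K F V (nfst (nsnd x)) /\
      forall i, i < nfst (nsnd x) -> forall j, j < i -> exists M,
        ccolour (nfst x) K F V (nfst (nsnd x)) (nsnd (nsnd x)) M i j))) \/
  (y = 0 /\ ((exists e, nmem e (nsnd (nsnd x)) /\ cedgeN (nfst x) e) \/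
   (1 < nfst (nsnd x) /\ (forall e, nmem e (nsnd (nsnd x)) -> cedge (nfst x) e) /\
    exists K, exists F, exists V, csub (nsnd (nsnd x)) F /\
      cert_Sep O (nfst x) K F V (nfst (nsnd x)) /\
      exists i, i < nfst (nsnd x) /\ exists j, j < i /\
        cconn (nfst x) (nsnd (nsnd x)) (nnth V i) (nnth V j)))).

Ltac re_ext_tac ::=
  lazymatch goal with
  | |- re (fun O x => nmem (@?a O x) (@?b O x)) => apply (@re_mem a b); comp_tac
  | |- re (fun O x => ~ nmem (@?a O x) (@?b O x)) => apply (@re_memN a b); comp_tac
  | |- re (fun O x => forall y, nmem y (@?b O x) -> @?R O x y) =>
      apply (@re_all_mem R b); [comp_tac | re_tac]
  | |- re (fun O x => univ (@?a O x) (@?b O x) (@?c O x)) =>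
      apply (@re_univ a b c); comp_tac
  end.

Section ReCertificates.
Implicit Types a b c d : set nat -> nat -> nat.

Lemma re_adj a b c : comp a -> comp b -> comp c ->
  re (fun O x => cadj (a O x) (b O x) (c O x)).
Proof. by move=> Ca Cb Cc; rewrite /cadj /cvert; re_tac. Qed.

Lemma re_conn a b c d : comp a -> comp b -> comp c -> comp d ->
  re (fun O x => cconn (a O x) (b O x) (c O x) (d O x)).
Proof. by move=> Ca Cb Cc Cd; rewrite /cconn /cadj /cvert /nedge; re_tac. Qed.

End ReCertificates.

Ltac re_ext_tac ::=
  lazymatch goal with
  | |- re (fun O x => nmem (@?a O x) (@?b O x)) => apply (@re_mem a b); comp_tac
  | |- re (fun O x => ~ nmem (@?a O x) (@?b O x)) => apply (@re_memN a b); comp_tac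
  | |- re (fun O x => forall y, nmem y (@?b O x) -> @?R O x y) =>
      apply (@re_all_mem R b); [comp_tac | re_tac]
  | |- re (fun O x => univ (@?a O x) (@?b O x) (@?c O x)) =>
      apply (@re_univ a b c); comp_tac
  | |- re (fun O x => cadj (@?a O x) (@?b O x) (@?c O x)) =>
      apply (@re_adj a b c); comp_tac
  | |- re (fun O x => cconn (@?a O x) (@?b O x) (@?c O x) (@?d O x)) =>
      apply (@re_conn a b c d); comp_tac
  end.

Lemma re_sep : re (fun O x => sep_rel O (nfst x) (nsnd x)).
Proof.
rewrite /sep_rel /cert_SepMax /cframe /ccover /czone /csub /ccolour /ccolour1 /csame
  /cfull /cedge /cedgeN /cadjN /cvert /nedge.
re_tac.
Qed.

Lemma re_ends : re (fun O x => ends_rel O (nfst x) (nsnd x)).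
Proof.
rewrite /ends_rel /cert_SepMax /cframe /ccover /czone /csub /cfull /cedge /cvert /nedge.
re_tac.
Qed.

Lemma re_sepmax : re (fun O x => sepmax_rel O (nfst x) (nsnd x)).
Proof.
rewrite /sepmax_rel /cert_Sep /cframe /ccover /csub /ccolour /ccolour1 /csame
  /cfull /cedge /cedgeN /cadjN /cvert /nedge.
re_tac.
Qed.

(** * Decoding numbers into finite sets of edges and vertices *)

Definition eset (F : nat) : set (nat * nat) := [set e | nmem (npair e.1 e.2) F].
Definition vset (K : nat) : set nat := [set x | nmem x K].

Lemma eset_edges_num s : eset (edges_num s) = [set` s].
Proof.
have -> : edges_num s = ncode [seq npair e.1 e.2 | e <- s] by elim: s => //= e s ->.
apply/seteqP; split=> e /=.
  move=> /nmem_code/mapP[e' es /npair_inj[]].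
  by case: e => e1 e2; case: e' es => a b es /= -> ->.
by move=> es; apply/nmem_code/mapP; exists e.
Qed.

Lemma edges_num_surj F : exists s, F = edges_num s.
Proof.
have [l ->] := ncode_surj F; exists [seq (nfst e, nsnd e) | e <- l].
by elim: l => //= e l <-; rewrite npair_eta.
Qed.

Lemma oracle_ofP (A : set (set (nat * nat))) F : oracle_of A F <-> A (eset F).
Proof.
split=> [[s [-> ]]|h]; first by rewrite eset_edges_num.
by have [s e] := edges_num_surj F; exists s; split=> //; rewrite -eset_edges_num -e.
Qed.

Lemma finite_eset F : finite_set (eset F).
Proof. by have [s ->] := edges_num_surj F; rewrite eset_edges_num; apply: finite_seq. Qed.

Lemma eset_finite (A : set (nat * nat)) : finite_set A -> exists F, A = eset F.
Proof. by move=> /finite_seqP[s ->]; exists (edges_num s); rewrite eset_edges_num. Qed.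

Lemma vset_finite (A : set nat) : finite_set A -> exists K, A = vset K.
Proof.
move=> /finite_seqP[s ->]; exists (ncode s); apply/seteqP.
by split=> x /nmem_code.
Qed.

Lemma eset0 : eset 0 = set0.
Proof. by have := eset_edges_num [::] => /= ->; apply/seteqP; split=> x. Qed.

Lemma eset_edge F u v : eset F (edge u v) <-> nmem (nedge u v) F.
Proof. by []. Qed.

Lemma nmem_eset F e : nmem e F <-> eset F (nfst e, nsnd e).
Proof. by rewrite /eset /= npair_eta. Qed.

Lemma csubP s F : csub s F <-> eset s `<=` eset F.
Proof.
split=> [h e /h//|h e]; by rewrite !nmem_eset; apply: h.
Qed.

Lemma csameP M x y : csame M x y <-> (vset M x <-> vset M y).
Proof.
rewrite /csame /vset /=; split=> [[[]|[]]//|h].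
by have [hx|hx] := pselect (nmem x M); [left; split=> //; apply/h|right; split=> // /h].
Qed.

Lemma edgesE G a b : edges G (a, b) <-> a < b /\ adj G a b.
Proof.
split=> [[u [v [uv [-> ->]]]]|[ab h]].
  have [lt|lt|e] := ltngtP u v; last by move: uv; rewrite e => /adj_irr.
    by [].
  by split=> //; apply: adj_sym.
by exists a, b; split=> //; rewrite /edge; congr pair; lia.
Qed.

Lemma all_endpoints G F (P : nat -> Prop) : eset F `<=` edges G ->
  (forall e, nmem e F -> P (nfst e) /\ P (nsnd e)) <->
  (forall x, endpoint G (eset F) x -> P x).
Proof.
move=> FG; split=> [h x [y [xy /h]]|h e].
  by rewrite /edge /= !npairK => -[]; have [] := leqP x y.
move=> /nmem_eset eF; have /edgesE[lt a] := FG _ eF.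
have ee : edge (nfst e) (nsnd e) = (nfst e, nsnd e) by rewrite /edge; congr pair; lia.
split; apply: h; first by exists (nsnd e); rewrite ee.
by exists (nfst e); rewrite edgeC ee; split=> //; apply: adj_sym.
Qed.

(** A code stores each edge as an increasing pair while the graph side quantifies over both
    orientations, hence the symmetry of [P]. *)
Lemma all_edge_pairs G F (P : nat -> nat -> Prop) : (forall x y, P x y -> P y x) ->
  eset F `<=` edges G ->
  (forall e, nmem e F -> P (nfst e) (nsnd e)) <->
  (forall x y, adj G x y -> eset F (edge x y) -> P x y).
Proof.
move=> sym FG; split=> [h x y xy /h|h e].
  by rewrite /edge /= !npairK; have [_|_ /sym] := leqP x y.
move=> /nmem_eset eF; have /edgesE[lt a] := FG _ eF; apply: h => //.
by have -> : edge (nfst e) (nsnd e) = (nfst e, nsnd e) by rewrite /edge; congr pair; lia.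
Qed.

Lemma nedge_pair G F e : eset F `<=` edges G -> nmem e F ->
  nedge (nfst e) (nsnd e) = e.
Proof.
move=> FG /nmem_eset/FG/edgesE[lt _]; rewrite -[RHS]npair_eta /nedge.
by congr npair; lia.
Qed.

(** * Meaning of the certificates in a described graph *)

Section Specification.
Variables (G : graph) (d : description).
Hypotheses (conG : connected G) (hc : highly_computable_by d G).
Let D := description_num d.

Lemma univ_vert u y : univ (nfst D) u y <-> eval set0 (vert_code d) u y.
Proof. by rewrite /D /description_num !npairK univP. Qed.

Lemma univ_adj x y : univ (nfst (nsnd D)) x y <-> eval set0 (adj_code d) x y.
Proof. by rewrite /D /description_num !npairK univP. Qed.

Lemma univ_deg x y : univ (nsnd (nsnd D)) x y <-> eval set0 (deg_code d) x y.
Proof. by rewrite /D /description_num !npairK univP. Qed.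

Lemma decides1 c x P : decides set0 c x P -> eval set0 c x 1 <-> P.
Proof.
move=> [h1 h0]; split=> [h|//]; apply: contrapT => /h0 h'.
by have := eval_fun h h'.
Qed.

Lemma decides0 c x P : decides set0 c x P -> eval set0 c x 0 <-> ~ P.
Proof. by move=> [h1 h0]; split=> [h /h1 h'|//]; have := eval_fun h h'. Qed.

Lemma cvertP u : cvert D u <-> vert G u.
Proof. by rewrite /cvert univ_vert; apply: decides1; case: hc. Qed.

Lemma cvertNP u : univ (nfst D) u 0 <-> ~ vert G u.
Proof. by rewrite univ_vert; apply: decides0; case: hc. Qed.

Lemma cadjP u v : cadj D u v <-> adj G u v.
Proof.
rewrite /cadj !cvertP univ_adj; have [_ _ ha _] := hc.
split=> [[hu [hv]]|uv]; first by move/(decides1 (ha u v hu hv)).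
have hu := adj_vert uv; have hv := adj_vertr uv.
by split=> //; split=> //; apply/(decides1 (ha u v hu hv)).
Qed.

Lemma cadjNP u v : cadjN D u v <-> ~ adj G u v.
Proof.
rewrite /cadjN !cvertP !cvertNP univ_adj; have [_ _ ha _] := hc.
split=> [[hu|[hv|[hu [hv]]]]|nuv].
- by move/adj_vert.
- by move/adj_vertr.
- by move/(decides0 (ha u v hu hv)).
have [hu|] := pselect (vert G u); last by left.
have [hv|] := pselect (vert G v); last by right; left.
by right; right; split=> //; split=> //; apply/(decides0 (ha u v hu hv)).
Qed.

Lemma cedgeP e : cedge D e <-> edges G (nfst e, nsnd e).
Proof. by rewrite /cedge cadjP edgesE. Qed.

Lemma cedgeNP e : cedgeN D e <-> ~ edges G (nfst e, nsnd e).
Proof.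
rewrite /cedgeN cadjNP edgesE; split=> [[h [h' _]|h [_ h']]|h]; [lia|by []|].
by have [lt|] := ltnP (nfst e) (nsnd e); [right => h'; apply: h|left].
Qed.

Lemma all_cedgeP s : (forall e, nmem e s -> cedge D e) <-> finite_edge_set G (eset s).
Proof.
split=> [h|[_ h] e]; last by rewrite nmem_eset cedgeP => /h.
by split=> [|e /h]; [exact: finite_eset|rewrite cedgeP !npairK -surjective_pairing].
Qed.

Lemma ex_cedgeNP s :
  (exists e, nmem e s /\ cedgeN D e) <-> ~ finite_edge_set G (eset s).
Proof.
rewrite -all_cedgeP; split=> [[e [es /cedgeNP ne]] h|h].
  by apply: ne; apply/cedgeP/h.
apply: contrapT => n; apply: h => e es; apply/cedgeP; apply: contrapT => ne.
by apply: n; exists e; split=> //; apply/cedgeNP.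
Qed.

Lemma cconnP F u v : cconn D F u v <-> conn G (eset F) u v.
Proof.
split=> [[L [n [<- [<- h]]]]|].
  elim: n h => [|n IH] h; first exact: conn_refl.
  apply: conn_trans (IH _) _; first by move=> j jn; apply: h; lia.
  by have [/cadjP a nF] := h n (ltnSn n); apply: rt_step; split.
suff H : conn G (eset F) u v -> exists f : nat -> nat, exists n, [/\ f 0 = u, f n = v &
    forall j, j < n -> del_adj G (eset F) (f j) (f j.+1)].
  move=> /H[f [n [f0 fn hf]]]; have [L hL] := nnth_finite f n.+1.
  exists L, n; rewrite !hL ?ltnS //; split=> //; split=> // j jn.
  by rewrite !hL; [|lia|lia]; have [a nF] := hf j jn; split=> //; apply/cadjP.
elim/clos_refl_trans_ind_left => [|x y _ [f [n [f0 fn hf]]] xy].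
  by exists (fun=> u), 0.
exists (fun j => if j <= n then f j else y), n.+1; split=> //; first by rewrite ltnn.
move=> j; rewrite ltnS leq_eqVlt => /orP[/eqP->|jn]; first by rewrite eqxx ltnn fn.
by rewrite jn orbT; apply: hf.
Qed.

Lemma cfullP F x : vert G x ->
  cfull D F x <-> forall y, adj G x y -> eset F (edge x y).
Proof.
move=> xG; have [lf _ _ hd] := hc; have [n An] := proj1 (finite_setP _) (lf x xG).
have dn := hd x n xG An.
split=> [[n' [L [/univ_deg dn' hL]]] y xy|h].
  have e := eval_fun dn' dn; subst n'.
  have inj : {in `I_n &, injective (nnth L)}.
    move=> i j; rewrite !inE /= => im jm eij.
    have [lt|lt|//] := ltngtP i j.
      by have [_ [_ /(_ i lt)]] := hL j jm.
    by have [_ [_ /(_ j lt)]] := hL i im; rewrite eij.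
  have sub : nnth L @` `I_n `<=` neighbors G x.
    by move=> _ [i /= im <-]; have [/cadjP] := hL i im.
  apply: contrapT => ny.
  (* A missing neighbour [y], appended to the [n] listed ones, would inject [n.+1] indices into a
     set of [n] neighbours. *)
  pose g i := if i < n then nnth L i else y.
  have nyi i : i < n -> nnth L i <> y.
    by move=> im eiy; have [_ [+ _]] := hL i im; rewrite eiy => /ny.
  have ginj : {in `I_n.+1 &, injective g}.
    move=> i j; rewrite !inE /g /= => im jm.
    case: ltnP => ni; case: ltnP => nj.
    - by apply: inj; rewrite inE.
    - by move/nyi => /(_ ni).
    - by move/esym/nyi => /(_ nj).
    - by move=> _; lia.
  have : `I_n.+1 #<= `I_n.
    rewrite -(card_le_eql (inj_card_eq ginj)) -(card_le_eqr An).
    apply: subset_card_le => _ [i /= im <-]; rewrite /g; case: ltnP => // ni.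
    by apply: sub; exists i.
  by rewrite card_le_II ltnn.
have /card_esym/pcard_eqP[f] := An; have [L hL] := nnth_finite f n.
exists n, L; split; first exact/univ_deg.
move=> j jn; rewrite hL //.
have xfj : adj G x (f j) by apply: (@funS _ _ `I_n (neighbors G x) f).
split; [exact/cadjP|split; first exact: h].
move=> i ij; rewrite hL; last by lia.
move=> /(@inj _ _ _ f); rewrite !inE /= => /(_ (ltn_trans ij jn) jn) eij.
by rewrite eij ltnn in ij.
Qed.

Lemma ccoverP K F V m x : ccover D K F V m x <->
  vset K x \/ exists2 l, l < m & conn G (eset F) x (nnth V l).
Proof.
rewrite /ccover; split=> -[h|[l h]]; [by left| |by left|].
  by case: h => lm /cconnP h; right; exists l.
by move=> h'; right; exists l; split=> //; apply/cconnP.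
Qed.

Lemma cframeP K F V m : cframe D K F V m <->
  frame G (vset K) (eset F) (nnth V) m /\ vset K `<=` vert G.
Proof.
split=> [[m0 [hV [hF hK]]]|[[[_ FG] hinc m0 hv hcov] KG]].
  have FE : finite_edge_set G (eset F) by apply/all_cedgeP => e /hF[].
  have KG : vset K `<=` vert G by move=> x /hK[/cvertP].
  split=> //; split=> //.
  - by move=> x y Kx; have [/cvertP xG /(cfullP _ xG)] := hK x Kx; apply.
  - by move=> i /hV/cvertP.
  - move=> x ex; apply/ccoverP; move: x ex; apply/all_endpoints; first by case: FE.
    by move=> e /hF[].
split=> //; split; first by move=> i /hv/cvertP.
split=> [e eF|x Kx]; last first.
  by have xG := KG x Kx; split; [exact/cvertP|apply/(cfullP _ xG) => y; apply: hinc].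
split; first by move/nmem_eset: eF => /FG ?; apply/cedgeP.
move: e eF; apply/(all_endpoints (ccover D K F V m) FG) => x /hcov.
by move/ccoverP.
Qed.

Lemma czoneP K F V m i j x : i < m -> j < m ->
  czone D K F V i j x <-> zone G (vset K) (eset F) (nnth V) m [set i; j] x.
Proof.
move=> im jm; rewrite /czone /zone /= !cconnP; split=> [[h|[h|h]]|[h|[l [[->|->] _ h]]]].
- by left.
- by right; exists i; split=> //; left.
- by right; exists j; split=> //; right.
- by left.
- by right; left.
- by right; right.
Qed.

Lemma ccolourP K F V m s M i j : eset F `<=` edges G ->
  ccolour D K F V m s M i j <->
  colouring G (vset K) (eset F) (nnth V) m (eset s) (vset M) i j.
Proof.
move=> FG.
have c1 x : ccolour1 D K F V m M x <-> vset K x \/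
    exists l, [/\ l < m, conn G (eset F) x (nnth V l) & vset M x <-> vset M (nnth V l)].
  rewrite /ccolour1; split=> -[h|[l]]; [by left| |by left|].
    by move=> [lm [/cconnP h /csameP h']]; right; exists l.
  by move=> [lm h h']; right; exists l; split=> //; split; [exact/cconnP|exact/csameP].
have e1 := all_endpoints (ccolour1 D K F V m M) FG.
pose P x y := eset s (edge x y) \/ csame M x y.
have Psym x y : P x y -> P y x.
  by case=> [h|/csameP h]; [left; rewrite edgeC|right; apply/csameP; tauto].
have e2 := all_edge_pairs Psym FG.
have PE e : nmem e F -> P (nfst e) (nsnd e) <-> nmem e s \/ csame M (nfst e) (nsnd e).
  by move=> eF; rewrite /P eset_edge (nedge_pair FG eF).
split=> [[Mi [Mj h]]|[Mi Mj h1 h2]].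
  split=> //.
  - move=> x y xy Fxy ns; have := proj1 e2 _ x y xy Fxy; case=> // [e eF|/csameP//].
    by apply/(PE e eF); case: (h e eF).
  - by move=> x ex; apply/c1; move: x ex; apply/e1 => e /h[].
split=> //; split=> // e eF; split; last first.
  by move: e eF; apply/e1 => x /h2/c1.
apply/(PE e eF); move: e eF; apply/e2 => x y xy Fxy.
have [ns|ns] := pselect (eset s (edge x y)); [by left|right].
exact/csameP/h1.
Qed.
End Specification.

Lemma frame_eq G K F v v' m : (forall i, i < m -> v' i = v i) ->
  frame G K F v m -> frame G K F v' m.
Proof.
move=> e [fF hinc m0 hv hcov]; split=> //; first by move=> i im; rewrite e //; apply: hv.
by move=> x /hcov[|[l lm h]]; [left|right; exists l; rewrite ?e].
Qed.

Lemma good_eq G F v v' m : (forall i, i < m -> v' i = v i) ->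
  good G F v m -> good G F v' m.
Proof.
move=> e gd i im; have [iv h] := gd i im; rewrite e //; split=> // j jm ji.
by rewrite e //; apply: h.
Qed.

(** * Soundness and completeness of the certificates *)

Section Correctness.
Variables (G : graph) (d : description) (k : nat).
Hypotheses (conG : connected G) (hc : highly_computable_by d G).
Hypothesis hk : number_of_ends G k.
Let D := description_num d.

Lemma subset_edges F H : finite_edge_set G (eset F) -> eset H `<=` eset F ->
  finite_edge_set G (eset H).
Proof. by move=> [_ FG] HF; split; [exact: finite_eset|move=> e /HF/FG]. Qed.

Lemma frame_codes s : 0 < k -> finite_edge_set G (eset s) ->
  exists K F V r, [/\ csub s F, cframe D K F V k, good G (eset F) (nnth V) k,
    linked G (vset K) r & vert G r] /\
    forall x y, adj G x y -> eset F (edge x y) -> vset K x \/ vset K y.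
Proof.
move=> k0 fs; have [lf _ _ _] := hc.
have [K' [F' [v [r [[fK KG sF fr] [gd lk rG inc]]]]]] := frame_exists conG lf hk k0 fs.
have [K eK] := vset_finite fK; have [F eF] := eset_finite (proj1 (frame_fin fr)).
have [V eV] := nnth_finite v k; subst K' F'.
exists K, F, V, r; split=> //; split=> //; first exact/csubP.
  by apply/(cframeP hc); split=> //; apply: frame_eq eV fr.
exact: good_eq eV gd.
Qed.

Lemma cert_SepMax_sound K F V m : 1 < k ->
  cert_SepMax (oracle_of (SepMax G)) D K F V m ->
  [/\ m = k, frame G (vset K) (eset F) (nnth V) m & good G (eset F) (nnth V) m].
Proof.
move=> k1 [/(cframeP hc)[fr KG] [/oracle_ofP/(SepMaxP _ hk)[FE aF] hp]].
(* Membership of [F] in [SepMax] gives [k <= m]. The opposite inequality comes at the end, from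
   goodness: [m] distinct infinite components cannot exceed the number of ends. *)
have km := frame_count conG fr (fun _ h => h) aF.
have pair i j : i < m -> j < i ->
  [/\ inf_comp G (eset F) (nnth V i), inf_comp G (eset F) (nnth V j) &
      ~ conn G (eset F) (nnth V i) (nnth V j)].
  move=> im ji; have jm := ltn_trans ji im.
  have [H [nH [/csubP HF hz]]] := hp i im j ji.
  apply: (distinct_of_not_atleast fr im jm aF _ HF).
    move=> aH; apply: nH; apply/oracle_ofP/(SepMaxP _ hk); split=> //.
    exact: subset_edges FE HF.
  pose P a b := eset H (edge a b) \/ czone D K F V i j a /\ czone D K F V i j b.
  have Psym x y : P x y -> P y x by rewrite /P edgeC; tauto.
  have FG := proj2 FE.
  have {}hz : forall x y, adj G x y -> eset F (edge x y) -> P x y.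
    apply/(all_edge_pairs Psym FG) => e eF.
    by rewrite /P eset_edge (nedge_pair FG eF); apply: hz.
  move=> a b ab Fab; have [h|[za zb]] := hz a b ab Fab; [by left|right].
  by split; apply/(czoneP hc).
have gd : good G (eset F) (nnth V) m.
  move=> i im; split.
    (* Infinity of a component is read off a pair. Index 0 is paired with 1, available because
       [1 < k <= m]; any other index is paired with 0. *)
    have [i0|i0] := eqVneq i 0; last by have [] := pair i 0 im; first lia.
    by have [||_ ? _] := pair 1 i; [lia|lia|].
  move=> j jm ji; have [lt|lt|e] := ltngtP i j; last by case: ji.
    by have [_ _ h] := pair j i jm lt; move/conn_sym.
  by have [] := pair i j im lt.
split=> //; have [bk _] := number_of_endsP hk.
apply/eqP; rewrite eqn_leq km andbT leqNgt; apply/negP => lt.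
by apply: (bk _ FE); apply: atleastW lt (good_atleast gd).
Qed.

Lemma cert_SepMax_complete s : 1 < k -> finite_edge_set G (eset s) ->
  exists K F V, csub s F /\ cert_SepMax (oracle_of (SepMax G)) D K F V k.
Proof.
move=> k1 fs; have k0 := ltnW k1.
have [K [F [V [r [[sF cf gd lk rG] inc]]]]] := frame_codes k0 fs.
have [fr KG] := proj1 (cframeP hc K F V k) cf; have FE := frame_fin fr.
exists K, F, V; split=> //; split=> //; split.
  by apply/oracle_ofP/(SepMaxP _ hk); split=> //; apply: (good_atleast gd).
move=> i im j ji; have jm := ltn_trans ji im.
pose H' := outside (eset F) (zone G (vset K) (eset F) (nnth V) k [set i; j]).
have [|H eH] := @eset_finite H'.
  by apply: sub_finite_set (proj1 FE) => e [].
have HF : eset H `<=` eset F by rewrite -eH => e [].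
exists H; split.
  move=> /oracle_ofP/(SepMaxP _ hk)[_]; rewrite -eH.
  exact: (outside_not_atleast conG fr lk rG inc).
split; first exact/csubP.
move=> e eF; have [eH'|nH] := pselect (nmem e H); [by left|right].
have Fe : eset F (edge (nfst e) (nsnd e)) by rewrite eset_edge (nedge_pair (proj2 FE) eF).
have [h|[z1 z2]] :=
  outside_edge (zone G (vset K) (eset F) (nnth V) k [set i; j]) Fe.
- by case: nH; move: h; rewrite -/H' eH eset_edge (nedge_pair (proj2 FE) eF).
- by split; apply/(czoneP hc _ _ _ _ im jm).
Qed.

Lemma cert_Sep_sound K F V : cert_Sep (oracle_of (Sep G)) D K F V k ->
  frame G (vset K) (eset F) (nnth V) k /\ good G (eset F) (nnth V) k.
Proof.
move=> [/(cframeP hc)[fr KG] hp]; split=> // i ik.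
have [H [z [/oracle_ofP/SepP[_ aH] [/csubP HF hz]]]] := hp i ik.
apply: (distinct_of_Sep conG fr HF aH (z := z)) => j jk ji.
by have [//|/(cconnP hc)] := hz j jk.
Qed.

Lemma cert_Sep_complete s : 1 < k -> finite_edge_set G (eset s) ->
  exists K F V, csub s F /\ cert_Sep (oracle_of (Sep G)) D K F V k.
Proof.
move=> k1 fs; have k0 := ltnW k1.
have [K [F [V [r [[sF cf gd lk rG] inc]]]]] := frame_codes k0 fs.
have [fr KG] := proj1 (cframeP hc K F V k) cf; have FE := frame_fin fr.
exists K, F, V; split=> //; split=> // i im.
pose H' := outside (eset F) (zone G (vset K) (eset F) (nnth V) k [set j | j <> i]).
have [|H eH] := @eset_finite H'.
  by apply: sub_finite_set (proj1 FE) => e [].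
have HF : eset H `<=` eset F by rewrite -eH => e [].
exists H, r; split.
  apply/oracle_ofP/SepP; split; first exact: subset_edges FE HF.
  by rewrite -eH; apply: outside_Sep.
split; first exact/csubP.
move=> j jm; have [ji|/eqP ji] := eqVneq j i; [by left|right].
apply/(cconnP hc); rewrite -eH; apply: conn_sym.
apply: (linked_conn conG fr lk rG inc); last exact: (frame_vert fr).
exact: zone_self.
Qed.

(** For at most one component no disconnection has to be preserved: an infinite component of an
    attaining set stays infinite when nothing is deleted, and then refines to [s]. *)
Lemma atleast_le1 s : k <= 1 -> finite_edge_set G s -> atleast G s k.
Proof.
move=> k1 [fs _]; have [_ [F _ [v hv]]] := number_of_endsP hk.
apply: (@atleast_refine _ set0) => //; exists v => i ik; have [iv _] := hv i ik.
by split=> [|j ji]; [exact: inf_compW iv|lia].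
Qed.

Lemma not_atleast_set0 : 1 < k -> ~ atleast G set0 k.
Proof.
move=> k1 [v hv]; have [i1 h] := hv 1 k1; have [i0 _] := hv 0 (ltnW k1).
apply: (h 0 isT).
by apply: conn_set0 => //; [exact: inf_comp_vert i1|exact: inf_comp_vert i0].
Qed.

Lemma oracle0_SepMax : oracle_of (SepMax G) 0 <-> k <= 1.
Proof.
rewrite oracle_ofP (SepMaxP _ hk) eset0.
have f0 : finite_edge_set G set0 by split; [exact: finite_set0|move=> ?].
split=> [[_ h]|k1]; last by split=> //; apply: atleast_le1.
by rewrite leqNgt; apply/negP => /not_atleast_set0.
Qed.

Lemma infinite_ends_gt0 : infinite_set (vert G) -> 0 < k.
Proof.
move=> iG; rewrite lt0n; apply/eqP => k0; have [bk _] := number_of_endsP hk.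
have f0 : finite_edge_set G set0 by split; [exact: finite_set0|move=> ?].
have [x xG] : exists x, vert G x.
  apply: contrapT => n; apply: iG; suff -> : vert G = set0 by exact: finite_set0.
  by apply/seteqP; split=> x // xG; apply: n; exists x.
apply: (bk _ f0); rewrite k0; exists (fun=> x) => -[|//] _; split=> // fx; apply: iG.
by apply: sub_finite_set fx => y yG; apply: conn_set0.
Qed.

Lemma ccolour_exists K F V m s i j : csub s F ->
  frame G (vset K) (eset F) (nnth V) m -> good G (eset F) (nnth V) m ->
  i < m -> j < m ->
  ~ conn G (eset s) (nnth V i) (nnth V j) <-> exists M, ccolour D K F V m s M i j.
Proof.
move=> /csubP sF fr gd im jm; have FG := proj2 (frame_fin fr).
split=> [|[M /(ccolourP hc _ _ _ _ _ _ _ FG)]]; last exact: colouring_nconn.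
move=> /(nconn_colouring fr sF im jm)[M' /vset_finite[M ->] h].
by exists M; apply/(ccolourP hc).
Qed.

Lemma sep_rel1 s : sep_rel (oracle_of (SepMax G)) (npair D s) 1 <-> Sep G (eset s).
Proof.
rewrite SepP /sep_rel !npairK oracle0_SepMax (all_cedgeP hc).
split=> [[[_ [/negP k1 [fs [K [F [V [m [sF [ct [i [im [j [ji hM]]]]]]]]]]]]]|[]]//|[fs a2]].
  rewrite -ltnNge in k1; have [_ fr gd] := cert_SepMax_sound k1 ct.
  split=> //; have jm := ltn_trans ji im.
  apply/(good_Sep conG fr gd (proj1 (csubP _ _) sF)).
  by exists i, j; split=> //; apply/(ccolour_exists sF fr gd im jm).
have k1 : 1 < k.
  rewrite ltnNge; apply/negP => k1; have [bk _] := number_of_endsP hk.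
  by apply: (bk _ fs); apply: atleastW a2.
left; split=> //; split; first by apply/negP; rewrite -ltnNge.
split=> //; have [K [F [V [sF ct]]]] := cert_SepMax_complete k1 fs.
exists K, F, V, k; split=> //; split=> //; have [_ fr gd] := cert_SepMax_sound k1 ct.
have [i [j [im ji nij]]] := proj1 (good_Sep conG fr gd (proj1 (csubP _ _) sF)) a2.
exists i; split=> //; exists j; split=> //.
exact/(ccolour_exists sF fr gd im (ltn_trans ji im)).
Qed.

Lemma sep_rel0 s : sep_rel (oracle_of (SepMax G)) (npair D s) 0 <-> ~ Sep G (eset s).
Proof.
have [bk _] := number_of_endsP hk.
rewrite SepP /sep_rel !npairK oracle0_SepMax (all_cedgeP hc) (ex_cedgeNP hc).
split=> [[[]//|[_ [k1 [fs a2]|[nfs []//|]]]]|n].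
- by apply: (bk _ fs); apply: atleastW a2.
- move=> [/negP k1 [fs [K [F [V [m [sF [ct h]]]]]]]] [_].
  rewrite -ltnNge in k1; have [_ fr gd] := cert_SepMax_sound k1 ct.
  move=> /(good_Sep conG fr gd (proj1 (csubP _ _) sF))[i [j [im ji]]]; apply.
  exact/(cconnP hc)/h.
right; split=> //; have [k1|k1] := leqP k 1; [by left|right].
have [fs|] := pselect (finite_edge_set G (eset s)); [right|by left].
split; first by [].
split=> //; have [K [F [V [sF ct]]]] := cert_SepMax_complete k1 fs.
exists K, F, V, k; split=> //; split=> // i im j ji.
apply/(cconnP hc); apply: contrapT => nij; apply: n; split=> //.
have [_ fr gd] := cert_SepMax_sound k1 ct.
by apply/(good_Sep conG fr gd (proj1 (csubP _ _) sF)); exists i, j.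
Qed.

(** When [O 0] holds the relation outputs 1, and the infinite vertex set excludes zero ends. *)
Lemma ends_relP m : infinite_set (vert G) ->
  ends_rel (oracle_of (SepMax G)) D m <-> m = k.
Proof.
move=> /infinite_ends_gt0 k0; rewrite /ends_rel oracle0_SepMax.
split=> [[[k1 ->]|[/negP k1 [K [F [V ct]]]]]|->]; first lia.
  by rewrite -ltnNge in k1; have [] := cert_SepMax_sound k1 ct.
have [k1|k1] := leqP k 1; [by left; lia|right; split=> //].
have [|K [F [V [_ ct]]]] := @cert_SepMax_complete 0 k1; last by exists K, F, V.
by rewrite eset0; split; [exact: finite_set0|move=> ?].
Qed.

Lemma sepmax_rel1 s :
  sepmax_rel (oracle_of (Sep G)) (npair D (npair k s)) 1 <-> SepMax G (eset s).
Proof.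
rewrite (SepMaxP _ hk) /sepmax_rel !npairK (all_cedgeP hc).
split=> [[[_ [fs h]]|[]//]|[fs ak]].
  split=> //; case: h => [k1|[k1 [K [F [V [sF [ct h]]]]]]]; first exact: atleast_le1.
  have [fr gd] := cert_Sep_sound ct.
  apply/(good_SepMax conG fr gd (proj1 (csubP _ _) sF)) => i im j ji.
  apply/(ccolour_exists sF fr gd im (ltn_trans ji im)); exact: h.
left; split=> //; split=> //; have [k1|k1] := leqP k 1; [by left|right; split=> //].
have [K [F [V [sF ct]]]] := cert_Sep_complete k1 fs.
exists K, F, V; split=> //; split=> // i im j ji.
have [fr gd] := cert_Sep_sound ct; apply/(ccolour_exists sF fr gd im (ltn_trans ji im)).
exact: (proj1 (good_SepMax conG fr gd (proj1 (csubP _ _) sF)) ak).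
Qed.

Lemma sepmax_rel0 s :
  sepmax_rel (oracle_of (Sep G)) (npair D (npair k s)) 0 <-> ~ SepMax G (eset s).
Proof.
rewrite (SepMaxP _ hk) /sepmax_rel !npairK (all_cedgeP hc) (ex_cedgeNP hc).
split=> [[[]//|[_ [nfs []//|]]]|n].
  move=> [k1 [fs [K [F [V [sF [ct [i [im [j [ji ij]]]]]]]]]]] [_].
  have [fr gd] := cert_Sep_sound ct.
  move=> /(good_SepMax conG fr gd (proj1 (csubP _ _) sF))/(_ i im j ji); apply.
  exact/(cconnP hc).
right; split=> //; have [fs|] := pselect (finite_edge_set G (eset s)); [right|by left].
have k1 : 1 < k.
  by rewrite ltnNge; apply/negP => k1; apply: n; split=> //; apply: atleast_le1.
split=> //; split=> //; have [K [F [V [sF ct]]]] := cert_Sep_complete k1 fs.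
exists K, F, V; split=> //; split=> //; have [fr gd] := cert_Sep_sound ct.
apply: contrapT => h; apply: n; split=> //.
apply/(good_SepMax conG fr gd (proj1 (csubP _ _) sF)) => i im j ji ij; apply: h.
by exists i; split=> //; exists j; split=> //; apply/(cconnP hc).
Qed.

End Correctness.

(** The two equivalences make 0 and 1 mutually exclusive, so the relation has exactly one value at
    [x], as the search program requires. *)
Lemma rel_decides (R : set nat -> nat -> nat -> Prop) O c x (P : Prop) :
  (forall y, R O x y -> (forall y', R O x y' -> y' = y) -> eval O c x y) ->
  (forall y, R O x y -> y = 0 \/ y = 1) ->
  (R O x 1 <-> P) -> (R O x 0 <-> ~ P) -> decides O c x P.
Proof.
move=> hc h01 h1 h0; split=> hP.
  apply: hc => [|y Ry]; first exact/h1.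
  by case: (h01 y Ry) => // y0; move: Ry; rewrite y0 => /h0.
apply: hc => [|y Ry]; first exact/h0.
by case: (h01 y Ry) => // y0; move: Ry; rewrite y0 => /h1.
Qed.

Theorem theorem5p6 :
  (exists ends_alg sep_alg : code,
     forall (G : graph) (d : description) (k : nat),
       connected G -> highly_computable_by d G -> number_of_ends G k ->
       (infinite_set (vert G) ->
          eval (oracle_of (SepMax G)) ends_alg (description_num d) k) /\
       (forall s : seq (nat * nat),
          decides (oracle_of (SepMax G)) sep_alg
            (npair (description_num d) (edges_num s))
            (Sep G [set` s])))
  /\
  (exists sepmax_alg : code,
     forall (G : graph) (d : description) (k : nat),
       connected G -> highly_computable_by d G -> number_of_ends G k ->
       forall s : seq (nat * nat),
         decides (oracle_of (Sep G)) sepmax_alg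
           (npair (description_num d) (npair k (edges_num s)))
           (SepMax G [set` s])).
Proof.
split.
  have [ends_alg He] := re_functional_code re_ends.
  have [sep_alg Hs] := re_functional_code re_sep.
  exists ends_alg, sep_alg => G d k conG hc hk; split=> [iG|s].
    have E m := ends_relP conG hc hk m iG.
    by apply: He => [|y /E]; first exact/E.
  rewrite -eset_edges_num; apply: (rel_decides (R := sep_rel)).
  - by move=> y; apply: Hs.
  - by move=> y [[]|[]]; [right|left].
  - exact: (sep_rel1 conG hc hk).
  - exact: (sep_rel0 conG hc hk).
have [c Hc] := re_functional_code re_sepmax.
exists c => G d k conG hc hk s.
rewrite -eset_edges_num; apply: (rel_decides (R := sepmax_rel)).
- by move=> y; apply: Hc.
- by move=> y [[]|[]]; [right|left].
- exact: (sepmax_rel1 conG hc hk).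
- exact: (sepmax_rel0 conG hc hk).
Qed.
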